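(* The Hodge filtration $\mathcal{F}_{H}:\mathrm{Mod}_{\mathcal{O}_{L},f}^{\varphi}\rightarrow\mathrm{Fil}_{\mathbb{F}}^{\mathbb{Z}}$ is compatible with tensor products, duals, symmetric and exterior powers. For every exact sequence \[ 0\rightarrow(M_{1},\varphi_{1})\rightarrow(M_{2},\varphi_{2})\rightarrow(M_{3},\varphi_{3})\rightarrow0 \] in $\mathrm{Mod}_{\mathcal{O}_{L},f}^{\varphi}$ with $r_{i}=\mathrm{rank}\, M_{i}$ (so that $r_{2}=r_{1}+r_{3}$), we have \[ t_{H}(M_{1},\varphi_{1})\ast t_{H}(M_{3},\varphi_{3})\leq t_{H}(M_{2},\varphi_{2})\quad\text{in}\quad\mathbb{Z}_{\geq}^{r_{2}} \] with equality if and only if for every $\gamma\in\mathbb{Z}$, the complex of $\mathbb{F}$-vector spaces \[ 0\rightarrow\mathcal{F}_{H}^{\gamma}(M_{1},\varphi_{1})\rightarrow\mathcal{F}_{H}^{\gamma}(M_{2},\varphi_{2})\rightarrow\mathcal{F}_{H}^{\gamma}(M_{3},\varphi_{3})\rightarrow0 \] is exact.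
   Context: $E$ is a finite extension of $\mathbb{Q}_p$ with uniformizer $\pi$ and residue field $\mathbb{F}_q$; $\mathbb{F}$ is the (perfect) residue field of a perfectoid field extension $K$ of $E$; $\mathcal{O}_L=W_{\mathcal{O}_E}(\mathbb{F})$ is the ring of $\mathcal{O}_E$-Witt vectors (a complete discrete valuation ring with uniformizer $\pi$ and residue field $\mathbb{F}$), $L=\mathrm{Frac}(\mathcal{O}_L)$, and $\varphi$ is the Frobenius lifting $x\mapsto x^q$. $\mathrm{Mod}_{\mathcal{O}_L,f}^{\varphi}$ is the category of finite free $\mathcal{O}_L$-modules $M$ equipped with an $L$-linear isomorphism $\varphi_M:(\varphi^*M)\otimes L\to M\otimes L$; short exact sequences are those which are exact on underlying modules; tensor constructions are the obvious ones (e.g. $(M_1\otimes M_2,\varphi_1\otimes\varphi_2)$, $(M^\vee,(\varphi_M^{\vee})^{-1})$). $\mathrm{Fil}^{\mathbb{Z}}_{\mathbb{F}}$ is the category of finite dimensional $\mathbb{F}$-vector spaces with a decreasing, exhaustive, separated $\mathbb{Z}$-filtration, with its usual tensor product $\mathcal{F}^\gamma(V_1\otimes V_2)=\sum_{\gamma_1+\gamma_2=\gamma}\mathcal{F}^{\gamma_1}(V_1)\otimes\mathcal{F}^{\gamma_2}(V_2)$, duals ($\mathcal{F}^\gamma(V^\vee)=$ annihilator of $\mathcal{F}^{1-\gamma}(V)$), symmetric and exterior powers (image filtrations from $V^{\otimes k}$). The Hodge filtration $\mathcal{F}_H(M,\varphi_M)$ is the $\mathbb{Z}$-filtration on $M\otimes\mathbb{F}=M/\pi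 M$ given, with $M'=\varphi_M(\varphi^*M)\subset M\otimes L$, by $\mathcal{F}_H^\gamma=(M\cap\pi^\gamma M'+\pi M)/\pi M$. Its type $t_H(M,\varphi_M)\in\mathbb{Z}^r_\ge=\{(\gamma_1\ge\dots\ge\gamma_r)\}$, $r=\mathrm{rank}\,M$, contains $\gamma$ with multiplicity $\dim_{\mathbb{F}}\mathcal{F}_H^{\gamma}/\mathcal{F}_H^{\gamma+1}$. On $\mathbb{Z}^r_\ge$: $(\gamma_i)\le(\gamma_i')$ iff $\gamma_1+\dots+\gamma_s\le\gamma'_1+\dots+\gamma'_s$ for all $s\le r$ with equality for $s=r$. $\ast:\mathbb{Z}^{r_1}_\ge\times\mathbb{Z}^{r_3}_\ge\to\mathbb{Z}^{r_1+r_3}_\ge$ concatenates and reorders. *)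

(* Defs.v *)
(* MathComp, with the classical and real-number layers of MathComp-Analysis. *)
From HB Require Import structures.
From mathcomp Require Import all_boot all_order all_algebra all_fingroup all_field.
From mathcomp Require Import sesquilinear boolp classical_sets reals.

Set Implicit Arguments.
Unset Strict Implicit.
Unset Printing Implicit Defensive.

Import Order.TTheory GRing.Theory Num.Theory.
Local Open Scope ring_scope.

Definition nonarch_abs (R : realType) (K : fieldType) (v : K -> R) : Prop :=
  [/\ forall x, 0 <= v x,
      forall x, v x = 0 <-> x = 0,
      {morph v : x y / x * y} &
      forall x y, v (x + y) <= Num.max (v x) (v y)].

Definition abs_complete (R : realType) (K : fieldType) (v : K -> R) : Prop :=
  forall u : nat -> K,
    (forall e : R, 0 < e -> exists N : nat, forall m n : nat,
        (N <= m)%N -> (N <= n)%N -> v (u m - u n) < e) ->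
    exists l : K, forall e : R, 0 < e -> exists N : nat, forall n : nat,
      (N <= n)%N -> v (u n - l) < e.

(* Q_p as the completion of Q for |p| = 1/p; these conditions force K to have
   characteristic 0, so that [ratr] is the embedding of Q. *)
Definition is_padic_field (R : realType) (p : nat) (K : fieldType)
    (v : K -> R) : Prop :=
  [/\ nonarch_abs v, abs_complete v, v p%:R = p%:R^-1 &
      forall (x : K) (e : R), 0 < e -> exists r : rat, v (x - ratr r) < e].

Definition is_ring_of_integers (R : realType) (K : fieldType) (v : K -> R)
    (O : comNzRingType) (i : {rmorphism O -> K}) : Prop :=
  injective i /\ (forall x : K, v x <= 1 <-> exists a : O, i a = x).

Definition is_residue_field (R : realType) (K : fieldType) (v : K -> R)
    (O : comNzRingType) (i : {rmorphism O -> K}) (k : fieldType)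
    (red : {rmorphism O -> k}) : Prop :=
  (forall c : k, exists a : O, red a = c) /\
  (forall a : O, red a = 0 <-> v (i a) < 1).

Definition is_perfectoid (R : realType) (p : nat) (K : fieldType) (v : K -> R)
  : Prop :=
  [/\ nonarch_abs v, abs_complete v, v p%:R < 1,
      forall e : R, 0 < e -> exists x : K, 1 - e < v x < 1 &
      forall x : K, v x <= 1 ->
        exists y : K, v y <= 1 /\ v (x - y ^+ p) <= v p%:R].

(* For perfect F, W_{O_E}(F) is the unique O_E-algebra which is pi-torsion free
   and pi-adically complete and separated, with reduction F modulo pi. *)
Definition is_ramified_witt (OE A : comNzRingType) (F : fieldType) (pi : OE)
    (j : {rmorphism OE -> A}) (k : {rmorphism OE -> F})
    (red : {rmorphism A -> F}) : Prop :=
  [/\ forall a : A, j pi * a = 0 -> a = 0,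
      forall a : A, (forall n : nat, exists b : A, a = j pi ^+ n * b) -> a = 0,
      forall u : nat -> A,
        (forall n : nat, exists b : A, u n.+1 - u n = j pi ^+ n * b) ->
        exists l : A, forall n : nat, exists b : A, u n - l = j pi ^+ n * b,
      (forall c : F, exists a : A, red a = c) /\
      (forall a : A, red a = 0 <-> exists b : A, a = j pi * b) &
      forall a : OE, red (j a) = k a].

Record witt_base (R : realType) := WittBase {
  wb_p : nat;
  wb_p_prime : prime wb_p;
  wb_Qp : fieldType;
  wb_absQp : wb_Qp -> R;
  wb_padic : is_padic_field wb_p wb_absQp;

  wb_E : fieldExtType wb_Qp;
  wb_absE : wb_E -> R;
  wb_absE_nonarch : nonarch_abs wb_absE;
  wb_absE_ext : forall a : wb_Qp, wb_absE a%:A = wb_absQp a;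
  wb_OE : comNzRingType;
  wb_inOE : {rmorphism wb_OE -> wb_E};
  wb_OE_integers : is_ring_of_integers wb_absE wb_inOE;
  wb_Fq : finFieldType;
  wb_redE : {rmorphism wb_OE -> wb_Fq};
  wb_Fq_residue : is_residue_field wb_absE wb_inOE wb_redE;
  wb_pi : wb_OE;
  wb_pi_uniformizer :
    forall a : wb_OE, wb_redE a = 0 <-> exists b : wb_OE, a = wb_pi * b;

  wb_K : fieldType;
  wb_absK : wb_K -> R;
  wb_K_perfectoid : is_perfectoid wb_p wb_absK;
  wb_EK : {rmorphism wb_E -> wb_K};
  wb_absK_ext : forall x : wb_E, wb_absK (wb_EK x) = wb_absE x;
  wb_OK : comNzRingType;
  wb_inOK : {rmorphism wb_OK -> wb_K};
  wb_OK_integers : is_ring_of_integers wb_absK wb_inOK;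
  wb_OEK : {rmorphism wb_OE -> wb_OK};
  wb_OEK_ext : forall a : wb_OE, wb_inOK (wb_OEK a) = wb_EK (wb_inOE a);
  wb_F : fieldType;
  wb_redK : {rmorphism wb_OK -> wb_F};
  wb_F_residue : is_residue_field wb_absK wb_inOK wb_redK;

  wb_OL : idomainType;
  wb_j : {rmorphism wb_OE -> wb_OL};
  wb_red : {rmorphism wb_OL -> wb_F};
  wb_OL_witt : is_ramified_witt wb_pi wb_j (wb_redK \o wb_OEK) wb_red;

  wb_frob : {rmorphism wb_OL -> wb_OL};
  wb_frob_OE : forall a : wb_OE, wb_frob (wb_j a) = wb_j a;
  wb_frob_lift : forall a : wb_OL, wb_red (wb_frob a) = wb_red a ^+ #|wb_Fq|;
  wb_frobL : {rmorphism {fraction wb_OL} -> {fraction wb_OL}};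
  wb_frobL_ext :
    forall a : wb_OL, wb_frobL (tofrac a) = tofrac (wb_frob a)
}.

Notation wb_L B := {fraction (wb_OL B)}.

Definition wb_piOL (R : realType) (B : witt_base R) : wb_OL B :=
  wb_j B (wb_pi B).
Definition wb_piL (R : realType) (B : witt_base R) : wb_L B :=
  tofrac (wb_piOL B).

Definition is_basis (A : nzRingType) (M : lmodType A) (n : nat)
    (e : 'I_n -> M) : Prop :=
  (forall m : M, exists c : 'I_n -> A, m = \sum_i c i *: e i) /\
  (forall c : 'I_n -> A, \sum_i c i *: e i = 0 -> forall i, c i = 0).

(* An object (M, phi_M), together with models [pm_gen] of M (x) L and [pm_fib]
   of M (x) F = M / pi M, each determined up to unique isomorphism by the map
   from M.  The L-linear isomorphism (phi^* M) (x) L -> M (x) L is encoded as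
   the corresponding bijective phi-semilinear map on M (x) L. *)
Record phimod (R : realType) (B : witt_base R) := PhiMod {
  pm_mod :> lmodType (wb_OL B);
  pm_rank : nat;
  pm_free : exists e : 'I_pm_rank -> pm_mod, is_basis e;

  pm_gen : lmodType (wb_L B);
  pm_inc : {linear pm_mod -> pm_gen | @tofrac (wb_OL B) \; *:%R};
  pm_inc_inj : injective pm_inc;
  pm_inc_frac : forall v : pm_gen, exists (a : wb_OL B) (m : pm_mod),
    a != 0 /\ tofrac a *: v = pm_inc m;

  pm_phi : {linear pm_gen -> pm_gen | wb_frobL B \; *:%R};
  pm_phi_bij : bijective pm_phi;

  pm_fib : vectType (wb_F B);
  pm_red : {linear pm_mod -> pm_fib | wb_red B \; *:%R};
  pm_red_surj : forall d : pm_fib, exists m : pm_mod, pm_red m = d;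
  pm_red_ker : forall m : pm_mod,
    pm_red m = 0 <-> exists n : pm_mod, m = wb_piOL B *: n
}.

Record phihom (R : realType) (B : witt_base R) (M N : phimod B) := PhiHom {
  ph_map :> {linear M -> N};
  ph_gen : {linear pm_gen M -> pm_gen N};
  ph_fib : 'Hom(pm_fib M, pm_fib N);
  ph_gen_ext : forall m : M, ph_gen (pm_inc M m) = pm_inc N (ph_map m);
  ph_fib_ext : forall m : M, ph_fib (pm_red M m) = pm_red N (ph_map m);
  ph_phi : forall v : pm_gen M, ph_gen (pm_phi M v) = pm_phi N (ph_gen v)
}.

Definition phi_short_exact (R : realType) (B : witt_base R)
    (M1 M2 M3 : phimod B) (f : phihom M1 M2) (g : phihom M2 M3) : Prop :=
  [/\ injective f,
      forall y : M2, g y = 0 <-> exists x : M1, f x = y &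
      forall z : M3, exists y : M2, g y = z].

(* The linear span of an arbitrary set of vectors, i.e. the least subspace
   containing it, which exists by [pspanP]. *)
Definition pspan (k : fieldType) (D : vectType k) (P : D -> Prop) :
    {vspace D} :=
  xget fullv [set U : {vspace D} |
    (forall d, P d -> d \in U) /\
    (forall W : {vspace D}, (forall d, P d -> d \in W) -> (U <= W)%VS)]%classic.

Lemma pspanP (k : fieldType) (D : vectType k) (P : D -> Prop) :
  (forall d, P d -> d \in pspan P) /\
  (forall W : {vspace D}, (forall d, P d -> d \in W) -> (pspan P <= W)%VS).
Proof.
rewrite /pspan.
apply: (@xgetPex _ fullv [set U : {vspace D} |
    (forall d, P d -> d \in U) /\
    (forall W : {vspace D}, (forall d, P d -> d \in W) -> (U <= W)%VS)]%classic).
pose Q n := `[< exists U : {vspace D},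
  \dim U = n /\ forall d, P d -> d \in U >].
have exQ : exists n, Q n.
  exists (\dim {: D}); apply/asboolP; exists fullv; split=> // d _.
  exact: memvf.
case: (ex_minnP exQ) => n /asboolP[U [dU PU]] min_n.
exists U; split=> // W PW; apply/capv_idPl/eqP.
rewrite eqEdim capvSl /= dU min_n //; apply/asboolP; exists (U :&: W)%VS.
by split=> // d Pd; rewrite memv_cap PU ?PW.
Qed.

(* M' = phi_M(phi^* M), the O_L-span of the semilinear image of M. *)
Definition phi_image (R : realType) (B : witt_base R) (M : phimod B)
    (v : pm_gen M) : Prop :=
  exists s : seq (wb_OL B * M),
    v = \sum_(am <- s) tofrac am.1 *: pm_phi M (pm_inc M am.2).

(* (M \cap pi^g M' + pi M) / pi M, as a subset of M / pi M. *)
Definition hodge_set (R : realType) (B : witt_base R) (M : phimod B) (g : int)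
    (d : pm_fib M) : Prop :=
  exists m n : M,
    (exists w, phi_image w /\ pm_inc M m = wb_piL B ^ g *: w) /\
    d = pm_red M (m + wb_piOL B *: n).

(* [hodge_set] is already a subspace, see [mem_hodge_fil]. *)
Definition hodge_fil (R : realType) (B : witt_base R) (M : phimod B) (g : int)
    : {vspace pm_fib M} :=
  pspan (@hodge_set R B M g).

Lemma pspan_id (k : fieldType) (D : vectType k) (P : D -> Prop) :
  P 0 -> (forall a x y, P x -> P y -> P (a *: x + y)) ->
  forall d, d \in pspan P <-> P d.
Proof.
move=> P0 PD d; split; last exact: (pspanP P).1.
pose Q n := `[< exists U : {vspace D},
  \dim U = n /\ forall d, d \in U -> P d >].
have exQ : exists n, Q n.
  exists 0%N; apply/asboolP; exists 0%VS; rewrite dimv0; split=> // x.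
  by rewrite memv0 => /eqP->.
have ubQ n : Q n -> (n <= \dim {: D})%N.
  by move=> /asboolP[U [<- _]]; apply/dimvS/subvf.
case: (ex_maxnP exQ ubQ) => n /asboolP[U [dU UP]] max_n.
suff PU x : P x -> x \in U by move=> /(subvP ((pspanP P).2 U PU)) /UP.
move=> Px; have UxP y : y \in (<[x]> + U)%VS -> P y.
  move=> /memv_addP[_ /vlineP[a ->] [z Uz ->]].
  by apply: PD => //; apply: UP.
have QUx : Q (\dim (<[x]> + U)) by apply/asboolP; exists (<[x]> + U)%VS.
have: (U == <[x]> + U)%VS by rewrite eqEdim addvSr /= dU max_n.
by move=> /eqP->; rewrite (subvP (addvSl _ _)) ?memv_line.
Qed.

Lemma mem_hodge_fil (R : realType) (B : witt_base R) (M : phimod B) (g : int)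
    (d : pm_fib M) :
  d \in hodge_fil M g <-> hodge_set g d.
Proof.
apply: pspan_id => [|c x1 x2].
  exists 0, 0; split; last by rewrite scaler0 addr0 linear0.
  exists 0; split; first by exists [::]; rewrite big_nil.
  by rewrite linear0 scaler0.
case=> m1 [n1 [[_ [[s1 ->] e1]] ->]] [m2 [n2 [[_ [[s2 ->] e2]] ->]]].
have [_ _ _ [/(_ c)[a <-] _] _] := wb_OL_witt B.
exists (a *: m1 + m2), (a *: n1 + n2); split; last first.
  have -> : a *: m1 + m2 + wb_piOL B *: (a *: n1 + n2) =
    a *: (m1 + wb_piOL B *: n1) + (m2 + wb_piOL B *: n2).
    by rewrite !scalerDr !scalerA (mulrC a) -!addrA; congr (_ + _);
       rewrite addrCA.
  by rewrite [RHS]linearP.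
exists (\sum_(am <- [seq (a * x.1, x.2) | x <- s1] ++ s2)
   tofrac am.1 *: pm_phi M (pm_inc M am.2)); split; first by eexists.
rewrite linearP /= e1 e2 big_cat big_map /= scalerDr; congr (_ + _).
rewrite scalerA mulrC -scalerA; congr (_ *: _); rewrite scaler_sumr.
by apply: eq_bigr => x _; rewrite rmorphM scalerA.
Qed.

Definition is_filtration (k : fieldType) (D : vectType k)
    (F : int -> {vspace D}) : Prop :=
  [/\ forall g h : int, g <= h -> (F h <= F g)%VS,
      forall d : D, exists g : int, d \in F g &
      forall d : D, (forall g : int, d \in F g) -> d = 0].

Definition is_type_of (k : fieldType) (D : vectType k)
    (F : int -> {vspace D}) (t : seq int) : Prop :=
  sorted >=%R t /\
  forall g : int, count_mem g t = (\dim (F g) - \dim (F (g + 1)%R))%N.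

Definition fil_type (k : fieldType) (D : vectType k)
    (F : int -> {vspace D}) : seq int :=
  xget [::] [set t | is_type_of F t]%classic.

Definition hodge_type (R : realType) (B : witt_base R) (M : phimod B) :
    seq int :=
  fil_type (hodge_fil M).

Definition type_concat (s t : seq int) : seq int := sort >=%R (s ++ t).

Definition type_le (s t : seq int) : Prop :=
  [/\ size s = size t,
      forall i : nat, (i <= size s)%N ->
        \sum_(x <- take i s) x <= \sum_(x <- take i t) x &
      \sum_(x <- s) x = \sum_(x <- t) x].

Section MultilinearMaps.

Variables (A : comNzRingType).

Definition ffun_upd (M : Type) (k : nat) (x : {ffun 'I_k -> M}) (i : 'I_k)
    (u : M) : {ffun 'I_k -> M} :=
  [ffun j => if j == i then u else x j].

Definition multilinear (M S : lmodType A) (k : nat)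
    (s : {ffun 'I_k -> M} -> S) : Prop :=
  forall x i (a : A) u v,
    s (ffun_upd x i (a *: u + v)) =
    a *: s (ffun_upd x i u) + s (ffun_upd x i v).

Definition symmetric_map (M S : lmodType A) (k : nat)
    (s : {ffun 'I_k -> M} -> S) : Prop :=
  forall (x : {ffun 'I_k -> M}) (w : {perm 'I_k}), s [ffun i => x (w i)] = s x.

Definition alternating_map (M S : lmodType A) (k : nat)
    (s : {ffun 'I_k -> M} -> S) : Prop :=
  forall (x : {ffun 'I_k -> M}) (i j : 'I_k), i != j -> x i = x j -> s x = 0.

Definition is_tensor_product (M N T : lmodType A)
    (b : {bilinear M -> N -> T}) : Prop :=
  forall (W : lmodType A) (c : {bilinear M -> N -> W}),
    exists f : {linear T -> W}, (forall x y, f (b x y) = c x y) /\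
      forall f' : {linear T -> W}, (forall x y, f' (b x y) = c x y) -> f' =1 f.

Definition is_dual (M N : lmodType A)
    (e : {bilinear M -> N -> A^o}) : Prop :=
  forall f : {linear M -> A^o},
    exists y : N, (forall x, e x y = f x) /\
      forall y' : N, (forall x, e x y' = f x) -> y' = y.

Definition is_sym_power (M S : lmodType A) (k : nat)
    (s : {ffun 'I_k -> M} -> S) : Prop :=
  [/\ multilinear s, symmetric_map s &
      forall (W : lmodType A) (c : {ffun 'I_k -> M} -> W),
        multilinear c -> symmetric_map c ->
        exists f : {linear S -> W}, (forall x, f (s x) = c x) /\
          forall f' : {linear S -> W}, (forall x, f' (s x) = c x) -> f' =1 f].

Definition is_ext_power (M S : lmodType A) (k : nat)
    (s : {ffun 'I_k -> M} -> S) : Prop :=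
  [/\ multilinear s, alternating_map s &
      forall (W : lmodType A) (c : {ffun 'I_k -> M} -> W),
        multilinear c -> alternating_map c ->
        exists f : {linear S -> W}, (forall x, f (s x) = c x) /\
          forall f' : {linear S -> W}, (forall x, f' (s x) = c x) -> f' =1 f].

End MultilinearMaps.

Arguments symmetric_map {A M S k} s.
Arguments alternating_map {A M S k} s.

(* In the next three records, (T, phi_T) is the tensor product, dual, or k-th
   symmetric or exterior power: T has its universal property over O_L, the
   structure map of T extends to the fibres over L and F, and phi_T is the map
   determined on T (x) L by the given Frobenii. *)
Record phi_tensor (R : realType) (B : witt_base R) (M N T : phimod B) :=
    PhiTensor {
  pt_map : {bilinear M -> N -> T};
  pt_univ : is_tensor_product pt_map;
  pt_gen : {bilinear pm_gen M -> pm_gen N -> pm_gen T};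
  pt_gen_ext : forall x y,
    pt_gen (pm_inc M x) (pm_inc N y) = pm_inc T (pt_map x y);
  pt_fib : {bilinear pm_fib M -> pm_fib N -> pm_fib T};
  pt_fib_ext : forall x y,
    pt_fib (pm_red M x) (pm_red N y) = pm_red T (pt_map x y);
  pt_phi : forall v w,
    pm_phi T (pt_gen v w) = pt_gen (pm_phi M v) (pm_phi N w)
}.

(* [pd_phi] says that phi_N is the inverse of the transpose of phi_M. *)
Record phi_dual (R : realType) (B : witt_base R) (M N : phimod B) :=
    PhiDual {
  pd_map : {bilinear M -> N -> (wb_OL B)^o};
  pd_univ : is_dual pd_map;
  pd_gen : {bilinear pm_gen M -> pm_gen N -> (wb_L B)^o};
  pd_gen_ext : forall x y,
    pd_gen (pm_inc M x) (pm_inc N y) = @tofrac (wb_OL B) (pd_map x y);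
  pd_fib : {bilinear pm_fib M -> pm_fib N -> (wb_F B)^o};
  pd_fib_ext : forall x y,
    pd_fib (pm_red M x) (pm_red N y) = wb_red B (pd_map x y);
  pd_phi : forall v w,
    pd_gen (pm_phi M v) (pm_phi N w) = wb_frobL B (pd_gen v w)
}.

Record phi_power (R : realType) (B : witt_base R) (k : nat) (M S : phimod B)
    (univ : ({ffun 'I_k -> M} -> S) -> Prop) := PhiPower {
  pp_map : {ffun 'I_k -> M} -> S;
  pp_univ : univ pp_map;
  pp_gen : {ffun 'I_k -> pm_gen M} -> pm_gen S;
  pp_gen_multilinear : multilinear pp_gen;
  pp_gen_ext : forall x : {ffun 'I_k -> M},
    pp_gen [ffun i => pm_inc M (x i)] = pm_inc S (pp_map x);
  pp_fib : {ffun 'I_k -> pm_fib M} -> pm_fib S;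
  pp_fib_multilinear : multilinear pp_fib;
  pp_fib_ext : forall x : {ffun 'I_k -> M},
    pp_fib [ffun i => pm_red M (x i)] = pm_red S (pp_map x);
  pp_phi : forall v : {ffun 'I_k -> pm_gen M},
    pm_phi S (pp_gen v) = pp_gen [ffun i => pm_phi M (v i)]
}.

Definition phi_sym_power (R : realType) (B : witt_base R) (k : nat)
    (M S : phimod B) :=
  phi_power (fun s : {ffun 'I_k -> M} -> S => is_sym_power s).

Definition phi_ext_power (R : realType) (B : witt_base R) (k : nat)
    (M S : phimod B) :=
  phi_power (fun s : {ffun 'I_k -> M} -> S => is_ext_power s).

Definition tensor_fil (k : fieldType) (D1 D2 D : vectType k)
    (b : D1 -> D2 -> D) (F1 : int -> {vspace D1}) (F2 : int -> {vspace D2})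
    (g : int) : {vspace D} :=
  pspan (fun d => exists (g1 g2 : int) (x : D1) (y : D2),
    [/\ g1 + g2 = g, x \in F1 g1, y \in F2 g2 & d = b x y]).

(* The annihilator of F^(1 - g). *)
Definition dual_fil (k : fieldType) (D D' : vectType k)
    (e : D -> D' -> k) (F : int -> {vspace D}) (g : int) : {vspace D'} :=
  pspan (fun y => forall x, x \in F (1 - g) -> e x y = 0).

(* The image under the map D^(x)n -> S induced by s of the tensor power
   filtration.  As F is decreasing, summing over g_1 + ... + g_n >= g instead of
   g_1 + ... + g_n = g only matters for n = 0, where it gives the unit object:
   the line D^(x)0 placed in degree 0. *)
Definition power_fil (k : fieldType) (n : nat) (D S : vectType k)
    (s : {ffun 'I_n -> D} -> S) (F : int -> {vspace D}) (g : int) :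
    {vspace S} :=
  pspan (fun d => exists (h : 'I_n -> int) (x : {ffun 'I_n -> D}),
    [/\ g <= \sum_i h i, forall i, x i \in F (h i) & d = s x]).

(* Exactness of 0 -> F1^g -> F2^g -> F3^g -> 0. *)
Definition fil_exact_at (k : fieldType) (D1 D2 D3 : vectType k)
    (f : 'Hom(D1, D2)) (h : 'Hom(D2, D3)) (F1 : int -> {vspace D1})
    (F2 : int -> {vspace D2}) (F3 : int -> {vspace D3}) (g : int) : Prop :=
  [/\ (F1 g :&: lker f = 0)%VS,
      (f @: F1 g = F2 g :&: lker h)%VS &
      (h @: F2 g = F3 g)%VS].

(* Main.v *)
Require Import Defs.
From HB Require Import structures.
From mathcomp Require Import all_boot all_order all_algebra all_fingroup all_field.
From mathcomp Require Import sesquilinear boolp classical_sets reals.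

Set Implicit Arguments.
Unset Strict Implicit.
Unset Printing Implicit Defensive.

Import Order.TTheory GRing.Theory Num.Theory.
Local Open Scope ring_scope.

(* O_L is a discrete valuation ring, so by the Smith normal form M has a basis
   (e_i) such that M' has basis (pi^(- gamma_i) e_i).  Then F_H^g is spanned by the
   reductions of the e_i with gamma_i >= g, and the gamma_i form the Hodge type.

   The products e_I of basis vectors generate a tensor, symmetric or exterior
   power S, and the pi^(- gamma_I) e_I generate S'.  The universal property gives a
   projection of S killing the e_I of degree gamma_I >= g.  It sends an element of
   S \cap pi^g S' into pi S, which therefore lies modulo pi in the span of the e_I of
   degree >= g, whether or not the e_I are independent.

   For an exact sequence, the lattices N_i = M_i + pi^n M_i' have index
   sum_k max(gamma_k - n, 0) over M_i.  As N_2 maps onto N_3 and contains N_1, these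
   indices are superadditive, for all n, which is majorization of the types once
   the totals are compared for n small.  If the types agree, then N_1 is the
   kernel of N_2 -> N_3 for all n, which says that F_H^g(M_1) is the kernel of
   F_H^g(M_2) -> F_H^g(M_3); surjectivity follows by counting dimensions. *)

(** * The discrete valuation ring O_L *)

(** The filtration is defined by intersections, and an element of M_3 \cap pi^g M_3' need not lift
    to M_2 \cap pi^g M_2'. Sums do lift, summand by summand, which is why types are compared through
    the lattices M + pi^n M'. The two points of view are tied by one remark: the reduction of x in M
    lies in F_H^g exactly when pi^(-1) x lies in M + pi^(g - 1) M'. The index of a lattice is read
    off as the valuation of a determinant: an inclusion of lattices is the integrality of a
    transition matrix, and equality is its invertibility. *)

Section DiscreteValuation.

Variables (R : realType) (B : witt_base R).

Local Notation A := (wb_OL B).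
Local Notation L := (wb_L B).
Local Notation pi := (wb_piOL B).
Local Notation piL := (wb_piL B).
Local Notation red := (wb_red B).

Lemma redP (a : A) : red a = 0 <-> exists b, a = pi * b.
Proof. by have [_ _ _ [_ +] _] := wb_OL_witt B; apply. Qed.

Lemma red_surj c : exists a : A, red a = c.
Proof. by have [_ _ _ [+ _] _] := wb_OL_witt B; apply. Qed.

Lemma red_pi : red pi = 0.
Proof. by apply/redP; exists 1; rewrite mulr1. Qed.

Lemma pi_neq0 : pi != 0.
Proof.
have [piI _ _ _ _] := wb_OL_witt B; apply/eqP => pi0.
by move: (piI 1); rewrite -/pi pi0 mul0r => /(_ erefl)/eqP; rewrite oner_eq0.
Qed.

Lemma pi_separated (a : A) : (forall n, exists b, a = pi ^+ n * b) -> a = 0.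
Proof. by have [_ + _ _ _] := wb_OL_witt B; apply. Qed.

(** Completeness makes O_L local: if the reduction of a is nonzero, some b satisfies a b = 1 - pi c,
    and the geometric series in pi c converges to an inverse of the right-hand side. That its limit
    is an inverse is checked modulo every pi^n. *)
Lemma unit_redE (a : A) : (a \is a GRing.unit) = (red a != 0).
Proof.
apply/idP/idP => [/(rmorph_unit red)|ra0]; first by rewrite unitfE.
have [b rb] := red_surj (red a)^-1.
have [c abE] : exists c, 1 - a * b = pi * c.
  by apply/redP; rewrite rmorphB rmorphM rb rmorph1 divff ?subrr.
have {abE}abE : a * b = 1 - pi * c by rewrite -abE subKr.
have [_ _ compl _ _] := wb_OL_witt B.
pose u n := \sum_(i < n) (pi * c) ^+ i.
have [n|l ul] := compl u.
  by exists (c ^+ n); rewrite /u big_ord_recr /= addrAC subrr add0r exprMn.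
suff lE : a * b * l = 1.
  by apply/unitrPr; exists (b * l); rewrite mulrA.
apply/eqP; rewrite -subr_eq0; apply/eqP/pi_separated => n.
have [d ud] := ul n.
exists (- (c ^+ n + a * b * d)).
have -> : l = u n - pi ^+ n * d by rewrite -ud subKr.
have uE : a * b * u n = 1 - (pi * c) ^+ n.
  by rewrite abE -[LHS]opprK -mulNr opprB -subrX1 opprB.
rewrite mulrBr uE exprMn mulrN mulrDr (mulrCA _ (pi ^+ n)).
by rewrite addrC !addrA addNr add0r opprD.
Qed.

Lemma piL_neq0 : piL != 0.
Proof. by rewrite tofrac_eq0 pi_neq0. Qed.

Lemma piL_nat n : tofrac (pi ^+ n) = piL ^ n%:Z.
Proof. by rewrite rmorphXn. Qed.

(** By separatedness some power of pi does not divide a. For the largest power that does, the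
    cofactor has nonzero reduction, hence is a unit. *)
Lemma pi_factor (a : A) : a != 0 ->
  exists n u, u \is a GRing.unit /\ a = pi ^+ n * u.
Proof.
move=> a0; have [N NP] : exists n, ~ exists b, a = pi ^+ n * b.
  by apply/existsNP => /pi_separated /eqP; rewrite (negPf a0).
elim: N NP => [[]|N IH NP]; first by exists a; rewrite mul1r.
have [/IH//|/contrapT[b aE]] := pselect (~ exists b, a = pi ^+ N * b).
exists N, b; split=> //; rewrite unit_redE; apply/eqP => /redP[c bE].
by apply: NP; exists c; rewrite aE bE exprSr mulrA.
Qed.

Lemma frac_repr (x : L) : exists a b : A, b != 0 /\ x = tofrac a / tofrac b.
Proof.
elim/quotW: x => x; exists x.1, x.2; split; first exact: denom_ratioP.
apply: (mulIf (x := tofrac x.2)); first by rewrite tofrac_eq0 denom_ratioP.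
rewrite divfK ?tofrac_eq0 ?denom_ratioP //; unlock tofrac.
rewrite -[LHS]FracField.pi_mul; apply/eqmodP => /=.
by rewrite FracField.equivfE /= !numden_Ratio ?oner_eq0 ?mulr1 ?denom_ratioP // mulrC.
Qed.

Lemma fracL_factor (x : L) : x != 0 ->
  exists z u, u \is a GRing.unit /\ x = piL ^ z * tofrac u.
Proof.
have [a [b [b0 ->]]] := frac_repr x => x0.
have a0 : a != 0 by apply: contraNneq x0 => ->; rewrite tofrac0 mul0r.
have [n [u [Uu ->]]] := pi_factor a0; have [m [v [Uv ->]]] := pi_factor b0.
exists (n%:Z - m%:Z), (u / v); rewrite unitrM Uu unitrV Uv; split=> //.
rewrite !tofracM !piL_nat rmorphV // invfM mulrACA; congr (_ * _).
by rewrite expfzDr ?piL_neq0 // invr_expz.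
Qed.

Lemma tofrac_unit_neq0 (a : A) : a \is a GRing.unit -> tofrac a != 0.
Proof. by rewrite tofrac_eq0; apply: contraTneq => ->; rewrite unitr0. Qed.

Definition integral (x : L) := exists a : A, x = tofrac a.

Lemma integral_pi z : 0 <= z -> integral (piL ^ z).
Proof. by case: z => // n _; exists (pi ^+ n); rewrite piL_nat. Qed.

Lemma integralM x y : integral x -> integral y -> integral (x * y).
Proof. by move=> [a ->] [b ->]; exists (a * b); rewrite tofracM. Qed.

(** The valuation of y is a - b, nonnegative because y lies in O_L, and y is a unit when it
    vanishes. This turns identities between determinants into inequalities between exponents. *)
Lemma unit_mul_pi (y u v : A) a b : u \is a GRing.unit -> v \is a GRing.unit ->
  piL ^ a * tofrac u = tofrac y * (piL ^ b * tofrac v) ->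
  b <= a /\ (a = b -> y \is a GRing.unit).
Proof.
move=> Uu Uv eq_uy.
have yE : tofrac y = piL ^ (a - b) * tofrac (u / v).
  have Uv' := tofrac_unit_neq0 Uv.
  rewrite expfzDr ?piL_neq0 // -invr_expz tofracM rmorphV // mulrACA eq_uy.
  rewrite -invfM mulfK ?mulf_neq0 //.
  exact: expfz_neq0 piL_neq0.
split=> [|ab]; last first.
  move: yE; rewrite ab subrr expr0z mul1r => /eqP; rewrite tofrac_eq => /eqP ->.
  by rewrite unitrM Uu unitrV.
rewrite -subr_ge0; case: (a - b) yE => // n yE.
have /eqP : tofrac (pi ^+ n.+1 * y) = tofrac (u / v).
  by rewrite tofracM yE mulrA piL_nat -expfzDr ?piL_neq0 // NegzE subrr mul1r.
rewrite tofrac_eq => /eqP uvE.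
have : u / v \is a GRing.unit by rewrite unitrM Uu unitrV.
by rewrite -uvE exprS -mulrA unitrM unit_redE red_pi eqxx.
Qed.

(** The valuation ring property: of two entries of a matrix over L, one divides the other, so that a
    pivot can be chosen. *)
Lemma integral_div (x y : L) : y != 0 -> integral (x / y) \/ integral (y / x).
Proof.
move=> y0; have [-> | x0] := eqVneq x 0.
  by left; exists 0; rewrite mul0r tofrac0.
have [a [u [Uu ->]]] := fracL_factor x0; have [b [v [Uv ->]]] := fracL_factor y0.
have int_u w z c d : w \is a GRing.unit -> z \is a GRing.unit -> c <= d ->
    integral (piL ^ d * tofrac w / (piL ^ c * tofrac z)).
  move=> Uw Uz cd; rewrite invfM mulrACA; apply: integralM.
    by rewrite invr_expz -expfzDr ?piL_neq0 //; apply: integral_pi; rewrite subr_ge0.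
  by exists (w / z); rewrite tofracM rmorphV.
by have [ba|/ltW ab] := leP b a; [left|right]; apply: int_u.
Qed.

End DiscreteValuation.

(** * Bases, spans and multilinear maps *)

Section Families.

Variables (A : comUnitRingType) (V : lmodType A).

(** Changes of basis become matrix products, so that determinants apply to modules known only up to
    isomorphism. *)
Definition mxact m n (X : 'M[A]_(m, n)) (v : 'I_n -> V) : 'I_m -> V :=
  fun i => \sum_j X i j *: v j.

Lemma mxactM m n p (X : 'M_(m, n)) (Y : 'M_(n, p)) v :
  mxact (X *m Y) v = mxact X (mxact Y v).
Proof.
apply: funext => i; rewrite /mxact.
under eq_bigr do rewrite mxE scaler_suml.
rewrite exchange_big; apply: eq_bigr => j _; rewrite scaler_sumr.
by apply: eq_bigr => k _; rewrite scalerA.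
Qed.

Lemma mxact1 n (v : 'I_n -> V) : mxact 1%:M v = v.
Proof.
apply: funext => i; rewrite /mxact (bigD1 i) //= big1 ?addr0 => [|j ji].
  by rewrite mxE eqxx scale1r.
by rewrite mxE eq_sym (negPf ji) scale0r.
Qed.

Lemma mxact_inj m n (v : 'I_n -> V) : is_basis v ->
  injective (fun X : 'M_(m, n) => mxact X v).
Proof.
move=> [_ freev] X Y XY; apply/matrixP => i j; apply/eqP; rewrite -subr_eq0.
apply/eqP; apply: (freev (fun j => X i j - Y i j)).
under eq_bigr do rewrite scalerBl.
by rewrite sumrB -!/(mxact _ _ i) XY subrr.
Qed.

Lemma basis_mxact n (v : 'I_n -> V) X : is_basis v -> X \in unitmx ->
  is_basis (mxact X v).
Proof.
move=> [genv freev] UX; split=> [m|c cX0].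
  have [c ->] := genv m.
  exists (fun i => ((\row_j c j) *m invmx X) 0 i).
  rewrite -[RHS]/(mxact _ (mxact X v) 0) -mxactM mulmxKV //.
  by apply: eq_bigr => i _; rewrite mxE.
have cX : (\row_j c j) *m X = 0.
  apply: (@mxact_inj _ _ v) => //; rewrite mxactM; apply: funext => i.
  rewrite [RHS]big1 => [|j _]; last by rewrite mxE scale0r.
  by rewrite -[RHS]cX0; apply: eq_bigr => j _; rewrite mxE.
move=> i; have := congr1 (fun Y : 'rV_n => (Y *m invmx X) 0 i) cX.
by rewrite /= mulmxK // mul0mx !mxE.
Qed.

Lemma gen_mxact m n (v : 'I_n -> V) (w : 'I_m -> V) :
  is_basis v -> exists X, w = mxact X v.
Proof.
move=> [genv _]; have [c cP] := choice (fun i => genv (w i)).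
exists (\matrix_(i, j) c i j); apply: funext => i; rewrite cP.
by apply: eq_bigr => j _; rewrite mxE.
Qed.

Lemma basis_change n (v w : 'I_n -> V) : is_basis v -> is_basis w ->
  exists2 X, X \in unitmx & w = mxact X v.
Proof.
move=> bv bw; have [X wX] := gen_mxact w bv; have [Y vY] := gen_mxact v bw.
exists X => //; suff XY : X *m Y = 1%:M by have [] := mulmx1_unit XY.
by apply: (mxact_inj bw); rewrite /= mxactM -vY -wX mxact1.
Qed.

Lemma basis_coord n (v : 'I_n -> V) : is_basis v ->
  exists co : 'I_n -> {linear V -> A^o},
    (forall m, m = \sum_i co i m *: v i) /\ forall i j, co i (v j) = (i == j)%:R.
Proof.
move=> [genv freev]; have [c cP] := choice genv.
have c_uniq m (a : 'I_n -> A) : m = \sum_i a i *: v i -> c m = a.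
  move=> ma; apply: funext => i; apply/eqP; rewrite -subr_eq0; apply/eqP.
  apply: (freev (fun i => c m i - a i)); under eq_bigr do rewrite scalerBl.
  by rewrite sumrB -cP -ma subrr.
have c_lin i : linear (fun m => c m i : A^o).
  move=> a m m'; rewrite (c_uniq _ (fun i => a * c m i + c m' i)) //.
  under eq_bigr do rewrite scalerDl -scalerA.
  by rewrite big_split -scaler_sumr /= -!cP.
pose co i : {linear V -> A^o} :=
  HB.pack (fun m => c m i : A^o) (GRing.isLinear.Build _ _ _ _ _ (c_lin i)).
exists co; split=> [m|i j]; first exact: cP.
rewrite /co /= (c_uniq _ (fun i => (i == j)%:R)) // (bigD1 j) //= eqxx scale1r.
by rewrite big1 ?addr0 // => k /negPf ->; rewrite scale0r.
Qed.

Lemma basis_linear n (v : 'I_n -> V) (W : lmodType A) (w : 'I_n -> W) :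
  is_basis v -> exists f : {linear V -> W}, forall i, f (v i) = w i.
Proof.
move=> /basis_coord[co [_ coE]].
have f_lin : linear (fun m => \sum_i co i m *: w i).
  move=> a m m'; rewrite scaler_sumr -big_split; apply: eq_bigr => i _ /=.
  by rewrite linearP scalerDl scalerA.
pose f : {linear V -> W} :=
  HB.pack (fun m => \sum_i co i m *: w i) (GRing.isLinear.Build _ _ _ _ _ f_lin).
exists f => i; rewrite /f /= (bigD1 i) //= coE eqxx scale1r big1 ?addr0 // => j ji.
by rewrite coE (negPf ji) scale0r.
Qed.

End Families.

Section Spans.

Variables (A L : nzRingType) (rho : {rmorphism A -> L}) (V : lmodType L).

(** Submodules over A of a module over L, by restriction along [rho]. With [tofrac] these include
    lattices such as M'; with [idfun] they are plain submodules of M. *)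
Definition submod_pred (Q : V -> Prop) : Prop :=
  Q 0 /\ forall a x y, Q x -> Q y -> Q (rho a *: x + y).

Lemma submod_sum (Q : V -> Prop) (I : Type) (r : seq I) (P : pred I) (a : I -> A)
    (v : I -> V) : submod_pred Q -> (forall i, P i -> Q (v i)) ->
  Q (\sum_(i <- r | P i) rho (a i) *: v i).
Proof.
move=> [Q0 QD] Qv; elim: r => [|i r IH]; first by rewrite big_nil.
by rewrite big_cons; case: ifP => // Pi; apply: QD => //; apply: Qv.
Qed.

Lemma submodD (Q : V -> Prop) x y : submod_pred Q -> Q x -> Q y -> Q (x + y).
Proof. by case=> _ QD Qx Qy; have := QD 1 _ _ Qx Qy; rewrite rmorph1 scale1r. Qed.

Lemma submodZ (Q : V -> Prop) a x : submod_pred Q -> Q x -> Q (rho a *: x).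
Proof. by case=> Q0 QD Qx; have := QD a _ _ Qx Q0; rewrite addr0. Qed.

Lemma submodB (Q : V -> Prop) x y : submod_pred Q -> Q x -> Q y -> Q (x - y).
Proof.
case=> _ QD Qx Qy; have := QD (-1) _ _ Qy Qx.
by rewrite rmorphN1 scaleN1r addrC.
Qed.

Definition lspan (I : finType) (w : I -> V) (v : V) : Prop :=
  exists a : I -> A, v = \sum_i rho (a i) *: w i.

Lemma lspan_submod (I : finType) (w : I -> V) : submod_pred (lspan w).
Proof.
split; first by exists (fun=> 0); rewrite big1 // => i _; rewrite rmorph0 scale0r.
move=> a _ _ [b ->] [c ->]; exists (fun i => a * b i + c i).
rewrite scaler_sumr -big_split; apply: eq_bigr => i _ /=.
by rewrite rmorphD rmorphM scalerDl scalerA.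
Qed.

Lemma lspan_sub (I : finType) (w : I -> V) (Q : V -> Prop) : submod_pred Q ->
  (forall i, Q (w i)) -> forall v, lspan w v -> Q v.
Proof. by move=> subQ Qw _ [a ->]; apply: submod_sum. Qed.

Lemma lspan_gen (I : finType) (w : I -> V) i : lspan w (w i).
Proof.
exists (fun j => (j == i)%:R); rewrite (bigD1 i) //= eqxx rmorph1 scale1r.
by rewrite big1 ?addr0 // => j /negPf ->; rewrite rmorph0 scale0r.
Qed.

End Spans.

Lemma ffun_upd_id (M : Type) k (x : {ffun 'I_k -> M}) i : ffun_upd x i (x i) = x.
Proof. by apply/ffunP => j; rewrite ffunE; case: eqP => [->|]. Qed.

Section Multilinear.

Variables (A L : comNzRingType) (rho : {rmorphism A -> L}) (M S : lmodType L).
Variables (k : nat) (s : {ffun 'I_k -> M} -> S).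
Hypothesis mul_s : multilinear s.

Lemma multilinear0 x i : s (ffun_upd x i 0) = 0.
Proof.
have := mul_s x i (-1) 0 0.
by rewrite scaler0 addr0 scaleN1r addNr.
Qed.

Lemma multilinearD x i u v :
  s (ffun_upd x i (u + v)) = s (ffun_upd x i u) + s (ffun_upd x i v).
Proof. by rewrite -[u in LHS]scale1r mul_s scale1r. Qed.

Lemma multilinearZ x i a u : s (ffun_upd x i (a *: u)) = a *: s (ffun_upd x i u).
Proof. by rewrite -[a *: u]addr0 mul_s multilinear0 addr0. Qed.

Lemma multilinear_span (I : finType) (w : I -> M) (Q : S -> Prop) :
  submod_pred rho Q -> (forall h : 'I_k -> I, Q (s [ffun i => w (h i)])) ->
  forall x : {ffun 'I_k -> M}, (forall i, lspan rho w (x i)) -> Q (s x).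
Proof.
move=> subQ Qw.
(* Coordinates are released one at a time: the first t are arbitrary elements of the span, the
   others are still generators. *)
suff Qt t (x : {ffun 'I_k -> M}) :
    (forall i : 'I_k, (i < t)%N -> lspan rho w (x i)) ->
    (forall i : 'I_k, (t <= i)%N -> exists j, x i = w j) -> Q (s x).
  by move=> x xw; apply: (Qt k) => // i; rewrite leqNgt ltn_ord.
elim: t x => [|t IH] x xspan xgen.
  have [h hP] := choice (fun i => xgen i (leq0n i)).
  suff -> : x = [ffun i => w (h i)] by [].
  by apply/ffunP => i; rewrite ffunE.
have [tk|kt] := ltnP t k; last first.
  by apply: IH => i; [move=> /ltnW|move=> ti]; last have := leq_trans kt ti;
     [apply: xspan | rewrite leqNgt ltn_ord].
pose i0 := Ordinal tk; rewrite -[x](ffun_upd_id _ i0).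
(* By linearity in coordinate t, the values u of that coordinate for which s lands in Q form a
   submodule, so it is enough to test generators. *)
apply: (@lspan_sub _ _ rho _ _ w (fun u => Q (s (ffun_upd x i0 u)))).
- split=> [|a u v Qu Qv]; first by rewrite multilinear0; case: subQ.
  by rewrite mul_s; case: subQ => _; apply.
- move=> j; apply: IH => i; rewrite ffunE.
    case: eqP => [-> _|_ it]; last by apply: xspan; rewrite ltnW.
    exact: lspan_gen.
  case: eqP => [_ _|/eqP ii0 ti]; first by exists j.
  by apply: xgen; rewrite ltn_neqAle eq_sym ti andbT.
- by apply: xspan; rewrite /= ltnSn.
Qed.

End Multilinear.

Record submodule (A : comNzRingType) (V : lmodType A) := Submodule {
  submod_mem :> V -> Prop;
  submod_memP : submod_pred (@idfun A) submod_mem }.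

Section SubmoduleType.

Variables (A : comNzRingType) (V : lmodType A) (U : submodule V).

Definition in_submod : {pred V} := fun v => `[< U v >].

Lemma in_submod_closed : submod_closed in_submod.
Proof.
have [U0 UD] := submod_memP U; split; first exact/asboolP.
by move=> a x y /asboolP Ux /asboolP Uy; apply/asboolP/UD.
Qed.

HB.instance Definition _ := GRing.isSubmodClosed.Build A V in_submod in_submod_closed.

(** The submodule as a module in its own right, so that it can be the target in a universal
    property. *)
Record submodType := SubmodType { submod_val : V; _ : submod_val \in in_submod }.

HB.instance Definition _ := [isSub for submod_val].
HB.instance Definition _ := [Choice of submodType by <:].
HB.instance Definition _ := [SubChoice_isSubLmodule of submodType by <:].

Lemma submodTypeP (x : submodType) : U (val x).
Proof. by apply/asboolP; have := valP x. Qed.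

Definition to_submod v (Uv : U v) : submodType := SubmodType (asboolT Uv).

End SubmoduleType.

(** * Smith normal form and adapted bases *)

Lemma total_preorder_min (T : finType) (t0 : T) (r : T -> T -> Prop) :
  (forall x y, r x y \/ r y x) -> (forall y x z, r x y -> r y z -> r x z) ->
  exists m, forall x, r m x.
Proof.
move=> r_total r_trans.
suff /(_ (enum T))[m mP] : forall s : seq T, exists m, forall x, x \in s -> r m x.
  by exists m => x; apply: mP; rewrite mem_enum.
elim=> [|y s [m mP]]; first by exists t0.
have r_refl x : r x x by case: (r_total x x).
by have [ym|my] := r_total y m; [exists y|exists m] => x;
  rewrite inE => /predU1P[->//|/mP] //; apply: r_trans.
Qed.

Section SmithForm.

Variables (R : realType) (B : witt_base R).

Local Notation A := (wb_OL B).
Local Notation L := (wb_L B).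
Local Notation "X ^F" := (map_mx (@tofrac A) X) (at level 2, format "X ^F").

(** By [integral_div], divisibility is a total preorder on the entries, and a minimal one divides
    all the others. The zero matrix is covered, with pivot 0. *)
Lemma min_entry m n (P : 'M[L]_(m.+1, n.+1)) :
  exists i0 j0, exists q : 'M[A]_(m.+1, n.+1), P = P i0 j0 *: q^F.
Proof.
pose r (x y : 'I_m.+1 * 'I_n.+1) := exists a : A, P y.1 y.2 = P x.1 x.2 * tofrac a.
have [||[i0 j0] ijP] := @total_preorder_min _ (ord0, ord0) r.
- move=> x y; rewrite /r; have [y0|y0] := eqVneq (P y.1 y.2) 0.
    by left; exists 0; rewrite y0 tofrac0 mulr0.
  have [[a aP]|[a aP]] := integral_div (P x.1 x.2) y0.
    by right; exists a; rewrite -aP mulrC divfK.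
  have [x0|x0] := eqVneq (P x.1 x.2) 0; last first.
    by left; exists a; rewrite -aP mulrC divfK.
  by right; exists 0; rewrite x0 tofrac0 mulr0.
- by move=> y x z [a aP] [b bP]; exists (a * b); rewrite bP aP tofracM mulrA.
have [q qP] := choice (fun ij => ijP ij).
exists i0, j0, (\matrix_(i, j) q (i, j)).
by apply/matrixP => i j; rewrite !mxE -(qP (i, j)).
Qed.

(** Dividing by a minimal entry p leaves an integral matrix q with entry 1 at the pivot. Once the
    pivot is moved to the corner, unipotent block matrices clear its row and column, and the
    induction continues with p times the Schur complement. *)
Lemma smith_form n (P : 'M[L]_n) : exists (U V : 'M[A]_n) (d : 'rV[L]_n),
  [/\ U \in unitmx, V \in unitmx & U^F *m P *m V^F = diag_mx d].
Proof.
elim: n P => [|n IH] P.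
  by exists 1%:M, 1%:M, 0; rewrite unitmx1; split=> //; apply/matrixP => -[].
have [i0 [j0 [q Pq]]] := min_entry P.
rewrite -[n.+1]/(1 + n)%N in P i0 j0 q Pq *.
pose q' : 'M_(1 + n) := xrow 0 i0 (xcol 0 j0 q).
pose r := ursubmx q'; pose c := dlsubmx q'.
pose p := P i0 j0.
pose L1 : 'M[A]_(1 + n) := block_mx 1%:M 0 (- c) 1%:M.
pose R1 : 'M[A]_(1 + n) := block_mx 1%:M (- r) 0 1%:M.
have [U' [V' [d' [UU' UV' UPV']]]] := IH (p *: (drsubmx q' - c *m r)^F).
exists (block_mx 1%:M 0 0 U' *m L1 *m tperm_mx 0 i0).
exists (tperm_mx 0 j0 *m R1 *m block_mx 1%:M 0 0 V').
exists (row_mx p%:M d'); split.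
- rewrite !unitmx_mul unitmx_perm andbT !unitmxE.
  by rewrite !det_lblock !det1 !mul1r unitr1 andbT -unitmxE.
- rewrite !unitmx_mul unitmx_perm /= !unitmxE.
  by rewrite det_lblock det_ublock !det1 !mul1r unitr1 -unitmxE.
rewrite Pq -/p -scalemxAr -scalemxAl -!map_mxM /=.
have -> : block_mx 1%:M 0 0 U' *m L1 *m tperm_mx 0 i0 *m q *m
     (tperm_mx 0 j0 *m R1 *m block_mx 1%:M 0 0 V') =
    block_mx 1%:M 0 0 U' *m (L1 *m q' *m R1) *m block_mx 1%:M 0 0 V'.
  by rewrite /q' xrowE xcolE !mulmxA.
(* If p = 0 then P = 0, and q need not have entry 1 at the pivot. *)
have [p0|p0] := eqVneq p 0.
  move: UPV'; rewrite p0 !scale0r mulmx0 mul0mx => /esym d0.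
  by rewrite diag_mx_row d0 !raddf0 -[RHS]/(block_mx 0 0 0 0) block_mx_const.
have q'ul : ulsubmx q' = 1%:M.
  have q00 : q i0 j0 = 1.
    have := congr1 (fun X : 'M_(n.+1) => X i0 j0) Pq; rewrite !mxE -/p => pE.
    apply/eqP; rewrite -tofrac_eq tofrac1 -(inj_eq (mulfI p0)) mulr1.
    by rewrite -pE.
  apply/matrixP => i j; rewrite !ord1 !mxE /= !lshift0 !tpermL.
  by rewrite q00.
have -> : L1 *m q' *m R1 = block_mx 1%:M 0 0 (drsubmx q' - c *m r).
  rewrite -[q' in LHS]submxK q'ul -/r -/c /L1 /R1 !mulmx_block.
  rewrite !(mul1mx, mulmx1, mul0mx, mulmx0, addr0, add0r).
  by rewrite !addNr mul0mx add0r mulNmx addrC.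
rewrite !mulmx_block !(mul1mx, mulmx1, mul0mx, mulmx0, addr0, add0r).
rewrite map_block_mx scale_block_mx !raddf0 diag_mx_row -UPV' !map_mxM /=.
rewrite -scalemxAr -scalemxAl; congr block_mx.
by apply/matrixP => i j; rewrite !ord1 !mxE eqxx !mulr1n tofrac1 mulr1.
Qed.

End SmithForm.

Lemma lspan_mxact_sub (A L : comUnitRingType) (rho : {rmorphism A -> L})
    (V : lmodType L) m n (X : 'M[A]_(m, n)) (w : 'I_n -> V) v :
  lspan rho (mxact (map_mx rho X) w) v -> lspan rho w v.
Proof.
apply: lspan_sub; first exact: lspan_submod.
by move=> i; exists (X i); apply: eq_bigr => j _; rewrite mxE.
Qed.

Lemma lspan_mxact (A L : comUnitRingType) (rho : {rmorphism A -> L})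
    (V : lmodType L) n (X : 'M[A]_n) (w : 'I_n -> V) v : X \in unitmx ->
  lspan rho (mxact (map_mx rho X) w) v <-> lspan rho w v.
Proof.
move=> UX; split; first exact: lspan_mxact_sub.
move=> wv; apply: (@lspan_mxact_sub _ _ _ _ _ _ (invmx X)).
by rewrite -mxactM -map_mxM mulVmx // map_mx1 mxact1.
Qed.

Section Lattices.

Variables (R : realType) (B : witt_base R).

Local Notation A := (wb_OL B).
Local Notation L := (wb_L B).
Local Notation pi := (wb_piOL B).
Local Notation piL := (wb_piL B).
Local Notation red := (wb_red B).
Local Notation "X ^F" := (map_mx (@tofrac A) X) (at level 2, format "X ^F").

Lemma common_denom (I : finType) (c : I -> L) :
  exists2 a : A, a != 0 & forall i, integral (tofrac a * c i).
Proof.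
have [p pP] := choice (fun i => frac_repr (c i)); have [q qP] := choice pP.
exists (\prod_i q i); first by apply/prodf_neq0 => i _; case: (qP i).
move=> i; have [q0 ->] := qP i; rewrite (bigD1 i) //= mulrC tofracM.
exists (p i * \prod_(j | j != i) q j).
by rewrite mulrA divfK ?tofrac_eq0 // tofracM.
Qed.

Section OneModule.

Variable M : phimod B.

Local Notation inc := (pm_inc M).
Local Notation phi := (pm_phi M).

Lemma incZ a m : inc (a *: m) = tofrac a *: inc m.
Proof. exact: linearZ. Qed.

Lemma inc_lincomb (I : finType) (P : pred I) (a : I -> A) (e : I -> M) :
  inc (\sum_(i | P i) a i *: e i) = \sum_(i | P i) tofrac (a i) *: inc (e i).
Proof. by rewrite linear_sum; apply: eq_bigr => i _; rewrite incZ. Qed.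

Lemma inc_mxact m n (X : 'M[A]_(m, n)) (e : 'I_n -> M) :
  (fun i => inc (mxact X e i)) = mxact X^F (fun i => inc (e i)).
Proof.
by apply: funext => i; rewrite inc_lincomb; apply: eq_bigr => j _; rewrite mxE.
Qed.

Lemma phiZ a v : phi (a *: v) = wb_frobL B a *: phi v.
Proof. exact: linearZ. Qed.

Lemma phi_lincomb (I : finType) (a : I -> L) (v : I -> pm_gen M) :
  phi (\sum_i a i *: v i) = \sum_i wb_frobL B (a i) *: phi (v i).
Proof. by rewrite linear_sum; apply: eq_bigr => i _; rewrite phiZ. Qed.

Lemma torsion_free a (m m' : M) : a != 0 -> a *: m = a *: m' -> m = m'.
Proof.
move=> a0 /(congr1 inc); rewrite !incZ => /(congr1 ( *:%R (tofrac a)^-1)).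
by rewrite !scalerA mulVf ?tofrac_eq0 // !scale1r; apply: pm_inc_inj.
Qed.

Lemma inc_basis r (e : 'I_r -> M) : is_basis e -> is_basis (fun i => inc (e i)).
Proof.
move=> [gen_e free_e]; split=> [v|c c0].
  have [a [m [a0 av]]] := pm_inc_frac v; have [c mc] := gen_e m.
  exists (fun i => (tofrac a)^-1 * tofrac (c i)).
  under eq_bigr do rewrite -scalerA; rewrite -scaler_sumr -inc_lincomb -mc -av.
  by rewrite scalerA mulVf ?tofrac_eq0 // scale1r.
have [a a0 /choice[b bP]] := common_denom c.
move=> i; apply: (mulfI (x := tofrac a)); first by rewrite tofrac_eq0.
rewrite mulr0 bP; apply/eqP; rewrite tofrac_eq0; apply/eqP; apply: free_e.
apply: (@pm_inc_inj _ _ M); rewrite inc_lincomb linear0.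
under eq_bigr do rewrite -bP -scalerA.
by rewrite -scaler_sumr c0 scaler0.
Qed.

Lemma phi_image_submod : submod_pred (@tofrac A) (@phi_image R B M).
Proof.
split; first by exists [::]; rewrite big_nil.
move=> a _ _ [s ->] [t ->]; exists ([seq (a * x.1, x.2) | x <- s] ++ t).
rewrite big_cat big_map /= scaler_sumr; congr (_ + _).
by apply: eq_bigr => x _; rewrite tofracM scalerA.
Qed.

Lemma phi_image_phi m : phi_image (phi (inc m)).
Proof. by exists [:: (1, m)]; rewrite big_seq1 tofrac1 scale1r. Qed.

Lemma phi_image_min (Q : pm_gen M -> Prop) : submod_pred (@tofrac A) Q ->
  (forall m, Q (phi (inc m))) -> forall w, phi_image w -> Q w.
Proof. by move=> subQ Qm _ [s ->]; apply: submod_sum. Qed.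

(** The Frobenius of L preserves O_L, so phi of an integral combination of the e_i is an integral
    combination of the phi(e_i). *)
Lemma phi_image_span (I : finType) (e : I -> M) :
  (forall m, lspan idfun e m) ->
  forall w, phi_image w <-> lspan (@tofrac A) (fun i => phi (inc (e i))) w.
Proof.
move=> gen_e w; split.
  apply: phi_image_min; first exact: lspan_submod.
  move=> m; have [a ->] := gen_e m; exists (fun i => wb_frob B (a i)).
  rewrite (inc_lincomb xpredT) phi_lincomb; apply: eq_bigr => i _.
  by rewrite wb_frobL_ext.
apply: lspan_sub; first exact: phi_image_submod.
by move=> i; apply: phi_image_phi.
Qed.

(** Since phi is bijective, each phi^(-1)(e_i) can be expanded in the e_j; applying phi expresses
    the e_i through the w_j. The matrix of w in the basis e is therefore invertible. *)
Lemma phi_basis r (e : 'I_r -> M) : is_basis e ->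
  is_basis (fun i => phi (inc (e i))).
Proof.
move=> /inc_basis basis_e; set w := fun i => phi _.
have [P wP] := gen_mxact w basis_e.
suff [Q eQ] : exists Q, (fun i => inc (e i)) = mxact Q w.
  rewrite wP; apply: basis_mxact => //.
  suff QP : Q *m P = 1%:M by have [] := mulmx1_unit QP.
  by apply: (mxact_inj basis_e); rewrite /= mxactM -wP -eQ mxact1.
have [phi' _ phi'K] := pm_phi_bij M.
have [gen_e _] := basis_e.
have [c cP] := choice (fun i => gen_e (phi' (inc (e i)))).
exists (\matrix_(i, j) wb_frobL B (c i j)); apply: funext => i.
rewrite -[LHS]phi'K cP phi_lincomb.
by apply: eq_bigr => j _; rewrite mxE.
Qed.

(* The lattice M' has basis pi^(- gamma_i) e_i. *)
Definition adapted r (e : 'I_r -> M) (gamma : 'I_r -> int) : Prop :=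
  is_basis e /\ forall w,
    phi_image w <-> lspan (@tofrac A) (fun i => piL ^ (- gamma i) *: inc (e i)) w.

Lemma basis_lspan r (e : 'I_r -> M) : is_basis e -> forall m, lspan idfun e m.
Proof. by case. Qed.

(** Let P be the matrix of phi(e0) in the basis e0, and U P V = diag(d). Then U P = diag(d) V^(-1).
    As U is invertible over O_L, M' is generated by the d_i e_i with e = V^(-1) e0, and gamma_i is
    minus the valuation of d_i. *)
Lemma adapted_exists r (e0 : 'I_r -> M) : is_basis e0 ->
  exists (e : 'I_r -> M) (gamma : 'I_r -> int), adapted e gamma.
Proof.
move=> basis_e0; have basis_ie0 := inc_basis basis_e0.
have [P UP phiP] := basis_change basis_ie0 (phi_basis basis_e0).
have [U [V [d [UU UV UPV]]]] := smith_form P.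
have d_neq0 i : d 0 i != 0.
  have : \det (diag_mx d) != 0.
    rewrite -UPV !det_mulmx; apply: mulf_neq0; first apply: mulf_neq0.
    - by rewrite det_map_mx; apply: tofrac_unit_neq0; rewrite -unitmxE.
    - by move: UP; rewrite unitmxE unitfE.
    - by rewrite det_map_mx; apply: tofrac_unit_neq0; rewrite -unitmxE.
  by rewrite det_diag => /prodf_neq0; apply.
have [z /choice[u dE]] := choice (fun i => fracL_factor (d_neq0 i)).
exists (mxact (invmx V) e0), (fun i => - z i).
split=> [|w]; first by apply: basis_mxact; rewrite ?unitmx_inv.
apply: iff_trans (phi_image_span (basis_lspan basis_e0) w) _.
rewrite phiP; apply: iff_trans (iff_sym (@lspan_mxact _ _ _ _ _ U _ w UU)) _.
have -> : mxact U^F (mxact P (fun i => inc (e0 i))) =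
    fun i => d 0 i *: inc (mxact (invmx V) e0 i).
  rewrite -mxactM (_ : _ *m P = diag_mx d *m (invmx V)^F); last first.
    by rewrite -UPV -mulmxA -map_mxM mulmxV // map_mx1 mulmx1.
  rewrite mxactM -inc_mxact; apply: funext => i.
  rewrite {1}/mxact (bigD1 i) //= mxE eqxx mulr1n [X in _ + X]big1 ?addr0 // => j ji.
  by rewrite mxE eq_sym (negPf ji) mulr0n scale0r.
split; apply: lspan_sub; try exact: lspan_submod.
  move=> i; have [_ ->] := dE i; rewrite mulrC -scalerA -[z i]opprK.
  exact: submodZ (lspan_submod _ _) (lspan_gen _ _ i).
move=> i; have [Uu dEi] := dE i; rewrite opprK.
have -> : piL ^ z i = tofrac (u i)^-1 * d 0 i.
  by rewrite dEi mulrCA -tofracM mulVr // tofrac1 mulr1.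
by rewrite -scalerA; exact: submodZ (lspan_submod _ _) (lspan_gen _ _ i).
Qed.

End OneModule.

End Lattices.

(** * The Hodge filtration in an adapted basis *)

Section HodgeFiltration.

Variables (R : realType) (B : witt_base R).

Local Notation A := (wb_OL B).
Local Notation L := (wb_L B).
Local Notation pi := (wb_piOL B).
Local Notation piL := (wb_piL B).
Local Notation red := (wb_red B).

Section OneModule.

Variable M : phimod B.

Local Notation inc := (pm_inc M).
Local Notation phi := (pm_phi M).
Local Notation redM := (pm_red M).

Lemma redMZ a m : redM (a *: m) = red a *: redM m.
Proof. exact: linearZ. Qed.

Lemma redM_lincomb (I : finType) (P : pred I) (a : I -> A) (e : I -> M) :
  redM (\sum_(i | P i) a i *: e i) = \sum_(i | P i) red (a i) *: redM (e i).
Proof. by rewrite linear_sum; apply: eq_bigr => i _; rewrite redMZ. Qed.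

(* The last clause makes M the direct sum of the parts spanned by the vectors of
   degree < g and of degree >= g; the family itself need not be free. *)
Definition graded_family (I : finType) (eps : I -> M) (gamma : I -> int) : Prop :=
  [/\ forall m, lspan idfun eps m,
      forall w, phi_image w ->
        lspan (@tofrac A) (fun i => piL ^ (- gamma i) *: inc (eps i)) w,
      forall i, phi_image (piL ^ (- gamma i) *: inc (eps i)) &
      forall g : int, exists p : {linear M -> M},
        forall i, p (eps i) = if gamma i < g then eps i else 0].

Lemma integer_bound (I : finType) (z : I -> int) :
  exists N : nat, forall i, `|z i| <= N%:Z.
Proof.
exists (\sum_i `|z i|)%N => i; rewrite -abszE lez_nat (bigD1 i) //=.
exact: leq_addr.
Qed.

Lemma hodge_fil_graded (I : finType) (eps : I -> M) (gamma : I -> int) g :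
  graded_family eps gamma ->
  hodge_fil M g = (\sum_(i | (g <= gamma i)%R) <[redM (eps i)]>)%VS.
Proof.
move=> [gen_eps genL_eps img_eps proj_eps].
apply/vspaceP => d; apply/idP/idP; last first.
  apply/subvP/subv_sumP => i gi; apply/subvP => _ /vlineP[c ->].
  rewrite memvZ //; apply/mem_hodge_fil.
  exists (eps i), 0; split; last by rewrite scaler0 addr0.
  have [a aE] : integral (piL ^ (gamma i - g)).
    by apply: integral_pi; rewrite subr_ge0.
  exists (tofrac a *: (piL ^ (- gamma i) *: inc (eps i))); split.
    exact: submodZ (phi_image_submod M) (img_eps i).
  rewrite -aE !scalerA -!expfzDr ?piL_neq0 //.
  by rewrite addrCA subrr addr0 subrr expr0z scale1r.
move=> /mem_hodge_fil[m [n [[w [Mw mw]] ->]]].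
rewrite linearD redMZ red_pi scale0r addr0.
have [b wE] := genL_eps _ Mw; have [p pE] := proj_eps g.
have [a mE] := gen_eps m.
(* Multiplication by pi^N makes the exponents N + g - gamma_i nonnegative, so that the expansion of
   m along M' becomes an identity in M, where p is defined. *)
have [N NP] := integer_bound (fun i => gamma i - g).
have [z zE] : exists z : I -> nat, forall i, (z i)%:Z = N%:Z + g - gamma i.
  exists (fun i => absz (N%:Z + g - gamma i)%R) => i; apply: gez0_abs.
  by have := le_trans (ler_norm _) (NP i); rewrite lerBlDr -subr_ge0.
have mN : pi ^+ N *: m = \sum_i (b i * pi ^+ z i) *: eps i.
  apply: (@pm_inc_inj _ _ M); rewrite inc_lincomb incZ mw wE.
  rewrite !scaler_sumr; apply: eq_bigr => i _.
  rewrite piL_nat tofracM piL_nat zE !scalerA; congr (_ *: _).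
  by rewrite mulrAC mulrC -!expfzDr ?piL_neq0.
(* For gamma_i < g the exponent is at least N + 1, one more than the power of pi that is
   cancelled. *)
have [n' pmE] : exists n', p m = pi *: n'.
  exists (\sum_(i | gamma i < g) (b i * pi ^+ (z i - N.+1)) *: eps i).
  apply: (@torsion_free _ _ _ (pi ^+ N)); first by rewrite expf_neq0 ?pi_neq0.
  rewrite -linearZ /= mN linear_sum scalerA -exprSr scaler_sumr [RHS]big_mkcond /=.
  apply: eq_bigr => i _; rewrite linearZ /= pE; case: ifP => gi; last by rewrite scaler0.
  rewrite scalerA mulrCA -exprD subnKC // -lez_nat zE intS addrC -addrA lerD2l.
  by rewrite -gtz0_ge1 subr_gt0.
(* This second expansion of m, with coefficients a_i from the generation of M, need not agree with
   the first; only the value of p m links them. *)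
have -> : m = p m + \sum_(i | g <= gamma i) a i *: eps i.
  rewrite {2}mE linear_sum {1}mE [X in _ + X]big_mkcond -big_split /=.
  apply: eq_bigr => i _; rewrite linearZ /= pE leNgt.
  by case: ifP; rewrite ?addr0 // scaler0 add0r.
rewrite linearD pmE redMZ red_pi scale0r add0r redM_lincomb.
by apply: memv_sumr => i _; apply/memvZ/memv_line.
Qed.

Lemma red_eq0 r (e : 'I_r -> M) (c : 'I_r -> A) : is_basis e ->
  \sum_i red (c i) *: redM (e i) = 0 -> forall i, red (c i) = 0.
Proof.
move=> basis_e; rewrite -redM_lincomb => /pm_red_ker[n nE] i.
have [a aE] := basis_lspan basis_e n.
apply/redP; exists (a i); apply/eqP; rewrite -subr_eq0; apply/eqP.
have [_ free_e] := basis_e; apply: (free_e (fun i => c i - pi * a i)).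
under eq_bigr do rewrite scalerBl -scalerA.
by rewrite sumrB nE aE -scaler_sumr subrr.
Qed.

Lemma dim_red_lines r (e : 'I_r -> M) (P : pred 'I_r) : is_basis e ->
  \dim (\sum_(i | P i) <[redM (e i)]>)%VS = #|P|.
Proof.
move=> basis_e.
have red0 (c : 'I_r -> wb_F B) : \sum_i c i *: redM (e i) = 0 -> forall i, c i = 0.
  have [a aE] := choice (fun i => red_surj (c i)).
  under eq_bigr do rewrite -aE.
  by move=> /(red_eq0 basis_e) c0 i; rewrite -aE.
have /directvP/= -> : directv (\sum_(i | P i) <[redM (e i)]>).
  apply/directv_sum_independent => us usP us0 i Pi.
  have /choice[c cE] : forall j, exists c, P j -> us j = c *: redM (e j).
    move=> j; case Pj: (P j); last by exists 0.
    by have /vlineP[c ->] := usP j Pj; exists c.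
  rewrite cE //; suff : (if P i then c i else 0) = 0.
    by rewrite Pi => ->; rewrite scale0r.
  apply: (red0 (fun i => if P i then c i else 0)); rewrite -[RHS]us0.
  rewrite [RHS]big_mkcond; apply: eq_bigr => j _.
  by case: ifP => [/cE ->|]; rewrite ?scale0r.
rewrite -sum1_card; apply: eq_bigr => i _; rewrite dim_vline.
case: eqP => // ri0; have := red0 (fun j => (j == i)%:R) _ i.
rewrite (bigD1 i) //= ri0 scaler0 add0r big1 => [/(_ erefl)/eqP|j /negPf ->].
  by rewrite eqxx oner_eq0.
by rewrite scale0r.
Qed.

Lemma red_full r (e : 'I_r -> M) : is_basis e ->
  (\sum_i <[redM (e i)]>)%VS = fullv.
Proof.
move=> basis_e; apply/eqP; rewrite eqEsubv subvf /=; apply/subvP => d _.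
have [m <-] := pm_red_surj d; have [a ->] := basis_lspan basis_e m.
by rewrite redM_lincomb; apply: memv_sumr => i _; apply/memvZ/memv_line.
Qed.

(** The size of a basis is the dimension of M / pi M. *)
Lemma rank_basis r (e : 'I_r -> M) : is_basis e -> pm_rank M = r.
Proof.
have dimE n (v : 'I_n -> M) : is_basis v -> \dim {:pm_fib M} = n.
  by move=> bv; rewrite -(red_full bv) (dim_red_lines _ bv) card_ord.
by move=> /dimE <-; have [v /dimE] := pm_free M.
Qed.

Lemma adapted_graded r (e : 'I_r -> M) gamma : adapted e gamma ->
  graded_family e gamma.
Proof.
move=> [basis_e imgE]; split=> [|w /imgE //|i|g]; first exact: basis_lspan.
  by apply/imgE; apply: lspan_gen.
exact: basis_linear.
Qed.

Lemma adapted_ex r : pm_rank M = r ->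
  exists (e : 'I_r -> M) (gamma : 'I_r -> int), adapted e gamma.
Proof. by case: _ /; have [e /adapted_exists] := pm_free M. Qed.

Lemma hodge_filE r (e : 'I_r -> M) gamma g : adapted e gamma ->
  hodge_fil M g = (\sum_(i | (g <= gamma i)%R) <[redM (e i)]>)%VS.
Proof. by move=> /adapted_graded; apply: hodge_fil_graded. Qed.

Lemma dim_hodge_fil r (e : 'I_r -> M) gamma g : adapted e gamma ->
  \dim (hodge_fil M g) = count (>= g) [seq gamma i | i <- enum 'I_r].
Proof.
move=> ad; rewrite (hodge_filE _ ad); have [basis_e _] := ad.
by rewrite dim_red_lines // count_map -sum1_count big_enum_cond -sum1_card.
Qed.

Lemma hodge_filtration : is_filtration (hodge_fil M).
Proof.
have [e [gamma ad]] := adapted_ex erefl.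
have [N NP] := integer_bound gamma.
split=> [g h gh|d|d dF].
- rewrite !(hodge_filE _ ad); apply/subv_sumP => i hi.
  by apply: (sumv_sup i) => //; apply: le_trans gh hi.
- exists (- N%:Z); rewrite (hodge_filE _ ad) (eq_bigl xpredT) => [|i].
    by have [basis_e _] := ad; rewrite red_full ?memvf.
  by apply: lerNnormlW; apply: NP.
- move: (dF (N%:Z + 1)); rewrite (hodge_filE _ ad) big_pred0 => [|i].
    by rewrite memv0 => /eqP.
  by apply/negbTE; rewrite -ltNge ltzD1; apply: le_trans (ler_norm _) (NP i).
Qed.

Lemma hodge_filS g h : g <= h -> (hodge_fil M h <= hodge_fil M g)%VS.
Proof. by have [+ _ _] := hodge_filtration; apply. Qed.

End OneModule.

Section Morphisms.

Variables (M N : phimod B) (f : phihom M N).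

Lemma ph_gen_image w : phi_image w -> phi_image (ph_gen f w).
Proof.
have [N0 ND] := phi_image_submod N; move: w; apply: phi_image_min.
  by split=> [|a x y Mx My]; rewrite ?linear0 ?linearP //; apply: ND.
by move=> m; rewrite ph_phi ph_gen_ext; apply: phi_image_phi.
Qed.

Lemma ph_fib_hodge g : (ph_fib f @: hodge_fil M g <= hodge_fil N g)%VS.
Proof.
apply/subvP => _ /memv_imgP[d /mem_hodge_fil[m [n [[w [Mw mw]] ->]]] ->].
apply/mem_hodge_fil; exists (f m), (f n); split; last first.
  by rewrite ph_fib_ext linearD linearZ.
exists (ph_gen f w); split; first exact: ph_gen_image.
by rewrite -ph_gen_ext mw linearZ.
Qed.

End Morphisms.

End HodgeFiltration.

(** * Symmetric and exterior powers *)

Lemma multilinear_scale (A : comNzRingType) (M S : lmodType A) k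
    (s : {ffun 'I_k -> M} -> S) (c : 'I_k -> A) (x : {ffun 'I_k -> M}) :
  multilinear s -> s [ffun i => c i *: x i] = (\prod_i c i) *: s x.
Proof.
move=> mul_s.
suff /(_ k (leqnn k)) : forall t, (t <= k)%N ->
    s [ffun i : 'I_k => if (i < t)%N then c i *: x i else x i] =
    (\prod_(i < k | (i < t)%N) c i) *: s x.
  under [X in _ = X *: _]eq_bigl do rewrite ltn_ord.
  move=> <-.
  by congr s; apply/ffunP => i; rewrite !ffunE ltn_ord.
elim=> [_|t IH tk].
  rewrite big_pred0 // scale1r; congr s.
  by apply/ffunP => i; rewrite ffunE.
pose i0 := Ordinal tk; rewrite (bigD1 i0) /=; last exact: ltnSn.
rewrite (eq_bigl (fun i : 'I_k => (i < t)%N)) => [|i]; last first.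
  by rewrite ltnS ltn_neqAle andbC.
rewrite -scalerA -IH ?(ltnW tk) //.
set y := [ffun i : 'I_k => if (i < t)%N then _ else _].
rewrite -[y](ffun_upd_id _ i0) ffunE /= ltnn.
rewrite -(multilinearZ mul_s); congr s.
apply/ffunP => i; rewrite !ffunE ltnS leq_eqVlt -[i == i0]/(val i == t).
by case: eqP => //= it; rewrite (_ : i = i0) //; apply: val_inj.
Qed.

Section CoordinateTruncation.

Variables (A : comUnitRingType) (M S : lmodType A) (k r : nat).
Variables (s : {ffun 'I_k -> M} -> S) (e : 'I_r -> M).
Variable co : 'I_r -> {linear M -> A^o}.
Hypothesis mul_s : multilinear s.
Hypothesis coE : forall i j, co i (e j) = (i == j)%:R.
Variable D : pred {ffun 'I_k -> 'I_r}.

Definition basis_tuple (h : {ffun 'I_k -> 'I_r}) : {ffun 'I_k -> M} :=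
  [ffun i => e (h i)].

(** The expansion of s along basis tuples, restricted to the terms in D. When D is stable under
    permutations it inherits the symmetry of s, so it factors through the power and gives the
    projection there. *)
Definition truncated_map (x : {ffun 'I_k -> M}) : S :=
  \sum_(h | D h) (\prod_i co (h i) (x i) : A) *: s (basis_tuple h).

Lemma truncated_multilinear : multilinear truncated_map.
Proof.
move=> x i a u v; rewrite scaler_sumr -big_split; apply: eq_bigr => h _ /=.
have prodE y : \prod_j co (h j) (ffun_upd x i y j) =
    (co (h i) y : A) * \prod_(j | j != i) co (h j) (x j).
  rewrite (bigD1 i) //= ffunE eqxx; congr (_ * _).
  by apply: eq_bigr => j /negPf ji; rewrite ffunE ji.
by rewrite !prodE linearP mulrDl scalerDl -mulrA scalerA.
Qed.

Lemma truncated_basis h :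
  truncated_map (basis_tuple h) = if D h then s (basis_tuple h) else 0.
Proof.
have prodE (h' : {ffun 'I_k -> 'I_r}) :
    \prod_i co (h' i) (basis_tuple h i) = (h' == h)%:R :> A.
  under eq_bigr do rewrite ffunE coE.
  have [->|] := eqVneq h' h; first by apply: big1 => i _; rewrite eqxx.
  move=> hh; have [i hi] : exists i, h' i != h i.
    apply/existsP; apply: contraNT hh => /existsPn/= hh.
    by apply/eqP/ffunP => i; apply/eqP; rewrite -[_ == _]negbK hh.
  by rewrite (bigD1 i) //= (negPf hi) mul0r.
rewrite /truncated_map; under eq_bigr do rewrite prodE.
case: ifP => Dh; last first.
  rewrite big1 // => h' Dh'; case: eqP => [hh|_]; last by rewrite scale0r.
  by rewrite hh Dh in Dh'.
rewrite (bigD1 h) //= eqxx scale1r big1 ?addr0 // => h' /andP[_ /negPf ->].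
by rewrite scale0r.
Qed.

Definition permute (w : {perm 'I_k}) (T : Type) (h : {ffun 'I_k -> T}) :=
  [ffun i => h (w i)].

Lemma permuteK w T : cancel (@permute w T) (@permute w^-1%g T).
Proof. by move=> h; apply/ffunP => i; rewrite !ffunE permKV. Qed.

Hypothesis D_perm : forall w h, D (permute w h) = D h.

Lemma prod_co_perm w h (x : {ffun 'I_k -> M}) :
  \prod_i co (permute w h i) (permute w x i) = \prod_i co (h i) (x i) :> A.
Proof.
rewrite [RHS](reindex_inj (@perm_inj _ w)).
by apply: eq_bigr => i _; rewrite !ffunE.
Qed.

Lemma basis_tuple_perm w h : basis_tuple (permute w h) = permute w (basis_tuple h).
Proof. by apply/ffunP => i; rewrite !ffunE. Qed.

Lemma truncated_symmetric : symmetric_map s -> symmetric_map truncated_map.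
Proof.
move=> sym_s x w; rewrite /truncated_map.
rewrite (reindex_inj (can_inj (@permuteK w 'I_r))).
apply: eq_big => h; first exact: D_perm.
by move=> _; rewrite prod_co_perm basis_tuple_perm sym_s.
Qed.

(** Polarization: expand s with x_i + x_j placed in both slots i and j. *)
Lemma alternating_tperm (x : {ffun 'I_k -> M}) i j : alternating_map s ->
  i != j -> s (permute (tperm i j) x) = - s x.
Proof.
move=> alt_s ij.
pose y u v := ffun_upd (ffun_upd x i u) j v.
have yE u v : y u v = ffun_upd (ffun_upd x j v) i u.
  apply/ffunP => l; rewrite !ffunE.
  case: (eqVneq l j) => [->|]; last by case: ifP.
  by rewrite (eq_sym j) (negPf ij).
have y0 u : s (y u u) = 0.
  by apply: (alt_s _ i j ij); rewrite !ffunE !eqxx; case: ifP.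
have yDl u u' v : s (y (u + u') v) = s (y u v) + s (y u' v).
  by rewrite !yE (multilinearD mul_s).
have yDr u v v' : s (y u (v + v')) = s (y u v) + s (y u v').
  exact: multilinearD.
have := y0 (x i + x j); rewrite yDl !yDr !y0 add0r addr0 => /eqP.
rewrite addrC addr_eq0 => /eqP.
have -> : y (x i) (x j) = x by rewrite yE !ffun_upd_id.
move=> <-; congr s; apply/ffunP => l; rewrite !ffunE.
case: tpermP => [->|->|/eqP/negPf -> /eqP/negPf ->//]; rewrite eqxx //.
by rewrite (negPf ij).
Qed.

(** Terms with h i = h j vanish because s is alternating. The others cancel in pairs under the
    transposition of i and j: the coefficient is unchanged since x i = x j, while s changes sign.
    Pairing h i < h j with h i > h j avoids any division by 2. *)
Lemma truncated_alternating : alternating_map s -> alternating_map truncated_map.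
Proof.
move=> alt_s x i j ij xij; rewrite /truncated_map.
rewrite (bigID (fun h : {ffun 'I_k -> 'I_r} => h i == h j)) /= big1 => [|h]; last first.
  case/andP=> _ /eqP hij; rewrite (alt_s _ _ _ ij) ?scaler0 //.
  by rewrite !ffunE hij.
rewrite add0r (bigID (fun h : {ffun 'I_k -> 'I_r} => (h i < h j)%N)) /=.
set t := tperm i j.
have xt : permute t x = x.
  by apply/ffunP => l; rewrite ffunE /t; case: tpermP => // ->.
rewrite [X in _ + X](reindex_inj (can_inj (@permuteK t 'I_r))) /=.
apply/eqP; rewrite addr_eq0 -sumrN; apply/eqP.
apply: eq_big => h.
  rewrite D_perm !ffunE tpermL tpermR -!andbA; congr (_ && _).
  by rewrite (eq_sym (h j)) -leqNgt ltn_neqAle -val_eqE andbA andbb.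
by rewrite -{2}xt prod_co_perm basis_tuple_perm alternating_tperm // scalerN opprK.
Qed.

End CoordinateTruncation.

Section Powers.

Variables (R : realType) (B : witt_base R).

Local Notation A := (wb_OL B).
Local Notation L := (wb_L B).
Local Notation pi := (wb_piOL B).
Local Notation piL := (wb_piL B).
Local Notation red := (wb_red B).

Lemma piL_sum (I : finType) (z : I -> int) :
  \prod_i piL ^ z i = piL ^ (\sum_i z i).
Proof.
apply/esym/(big_morph (fun n => piL ^ n)); last exact: expr0z.
by move=> a b; rewrite expfzDr ?piL_neq0.
Qed.

(* The corestriction of s to U factors through S, and by uniqueness the
   composite with the inclusion of U is the identity of S. *)
Lemma power_gen (k : nat) (A0 : comNzRingType) (M S : lmodType A0)
    (s : {ffun 'I_k -> M} -> S) (U : submodule S) :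
  is_sym_power s \/ is_ext_power s -> (forall x, U (s x)) -> forall y, U y.
Proof.
move=> univ_s Us.
pose c x : submodType U := to_submod (Us x).
have mul_c : multilinear s -> multilinear c.
  move=> mul_s x i a u v; apply: val_inj.
  by rewrite linearP /= mul_s.
have retract (f : {linear S -> submodType U}) (g : {linear S -> S}) :
    (forall x, f (s x) = c x) ->
    (forall g' : {linear S -> S}, (forall x, g' (s x) = s x) -> g' =1 g) ->
    forall y, U y.
  move=> fs g_uniq y; suff <- : val (f y) = y by apply: submodTypeP.
  rewrite -[LHS]/((val \o f) y) (g_uniq (val \o f)) => [|x].
    by rewrite -(g_uniq idfun).
  by rewrite /= fs.
case: univ_s => -[mul_s prop_s univ].
- have [||f [fs _]] := univ _ c; first exact: mul_c.
    by move=> x w; apply/val_inj/prop_s.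
  have [g [_ g_uniq]] := univ S s mul_s prop_s.
  exact: retract fs g_uniq.
- have [||f [fs _]] := univ _ c; first exact: mul_c.
    by move=> x i j ij xij; apply/val_inj/(prop_s _ _ _ ij xij).
  have [g [_ g_uniq]] := univ S s mul_s prop_s.
  exact: retract fs g_uniq.
Qed.

Section OnePower.

Variables (k : nat) (M S : phimod B) (univ : ({ffun 'I_k -> M} -> S) -> Prop).
Variable P : phi_power univ.
Hypothesis univ_power :
  is_sym_power (pp_map P) \/ is_ext_power (pp_map P).

Lemma pp_map_multilinear : multilinear (pp_map P).
Proof. by case: univ_power => -[]. Qed.

Lemma pp_gen_image (w : {ffun 'I_k -> pm_gen M}) :
  (forall i, phi_image (w i)) -> phi_image (pp_gen P w).
Proof.
have [e basis_e] := pm_free M => Mw.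
have imgE := phi_image_span (basis_lspan basis_e).
apply: (multilinear_span (pp_gen_multilinear P) (phi_image_submod S)
  (w := fun i => pm_phi M (pm_inc M (e i)))) => [h|i]; last exact/imgE.
have -> : [ffun i => pm_phi M (pm_inc M (e (h i)))] =
    [ffun i => pm_phi M ([ffun i => pm_inc M ([ffun i => e (h i)] i)] i)].
  by apply/ffunP => i; rewrite !ffunE.
by rewrite -pp_phi pp_gen_ext; apply: phi_image_phi.
Qed.

Section AdaptedBasis.

Variables (r : nat) (e : 'I_r -> M) (gamma : 'I_r -> int).
Hypothesis ad : adapted e gamma.

Local Notation eps := (fun h : {ffun 'I_k -> 'I_r} => pp_map P (basis_tuple e h)).
Local Notation deg := (fun h : {ffun 'I_k -> 'I_r} => \sum_i gamma (h i)).

Lemma pp_gen_basis (h : 'I_k -> 'I_r) :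
  pp_gen P [ffun i => piL ^ (- gamma (h i)) *: pm_inc M (e (h i))] =
  piL ^ (- (\sum_i gamma (h i))) *: pm_inc S (pp_map P [ffun i => e (h i)]).
Proof.
rewrite -pp_gen_ext -sumrN -piL_sum -multilinear_scale; last first.
  exact: pp_gen_multilinear.
by congr (pp_gen P _); apply/ffunP => i; rewrite !ffunE.
Qed.

(** The degree of a tuple does not depend on the order of its entries, so truncation by degree
    respects both symmetry and alternation. *)
Lemma power_truncation g : exists p : {linear S -> S}, forall h,
  p (eps h) = if deg h < g then eps h else 0.
Proof.
have [/basis_coord[co [_ coE]] _] := ad.
pose D := [pred h : {ffun 'I_k -> 'I_r} | deg h < g].
have D_perm w h : D (permute w h) = D h.
  rewrite /D /= [in RHS](reindex_inj (@perm_inj _ w)).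
  by under eq_bigr do rewrite ffunE.
pose c := truncated_map (pp_map P) e co D.
have mul_c : multilinear c by apply: truncated_multilinear.
suff [p pE] : exists p : {linear S -> S}, forall x, p (pp_map P x) = c x.
  exists p => h; rewrite pE.
  by apply: truncated_basis coE _ _.
case: univ_power => -[mul_s sym_s univ_s].
  have [|p [pE _]] := univ_s S c mul_c; last by exists p.
  exact: truncated_symmetric.
have [|p [pE _]] := univ_s S c mul_c; last by exists p.
exact: truncated_alternating.
Qed.

Lemma power_graded : graded_family eps deg.
Proof.
have mul_s := pp_map_multilinear; have [basis_e imgE] := ad.
have gen_eps m : lspan idfun eps m.
  pose U := Submodule (lspan_submod idfun eps).
  apply: (@power_gen _ _ _ _ (pp_map P) U) => // x.
  apply: (multilinear_span mul_s (lspan_submod idfun eps) (w := e)) => [h|i].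
    have -> : [ffun i => e (h i)] = basis_tuple e [ffun i => h i].
      by apply/ffunP => i; rewrite !ffunE.
    exact: lspan_gen.
  exact: basis_lspan.
split=> // [w|h|]; last exact: power_truncation.
- apply: phi_image_min; first exact: lspan_submod.
  (* The m whose image under phi lies in the required lattice form a submodule of S, so by
     [power_gen] only the values of the universal map need be tested. *)
  have subU : submod_pred idfun (fun m => lspan (@tofrac A)
      (fun h => piL ^ (- deg h) *: pm_inc S (eps h)) (pm_phi S (pm_inc S m))).
    have [Q0 QD] := lspan_submod (@tofrac A)
      (fun h => piL ^ (- deg h) *: pm_inc S (eps h)).
    split=> [|a x y Qx Qy]; first by rewrite !linear0.
    by rewrite !linearP /= wb_frobL_ext; apply: QD.
  apply: (@power_gen _ _ _ _ (pp_map P) (Submodule subU)) => //= x.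
  rewrite -pp_gen_ext pp_phi.
  apply: (multilinear_span (pp_gen_multilinear P) (lspan_submod _ _)
    (w := fun j => piL ^ (- gamma j) *: pm_inc M (e j))) => [h|i].
    rewrite pp_gen_basis; pose h0 : {ffun 'I_k -> 'I_r} := [ffun i => h i].
    have -> : \sum_i gamma (h i) = deg h0 by apply: eq_bigr => i _; rewrite ffunE.
    have -> : [ffun i => e (h i)] = basis_tuple e h0.
      by apply/ffunP => i; rewrite !ffunE.
    exact: (lspan_gen _ (fun h => piL ^ (- deg h) *: pm_inc S (eps h))).
  by rewrite !ffunE; apply/imgE/phi_image_phi.
- rewrite -pp_gen_basis; apply: pp_gen_image => i; rewrite ffunE.
  by apply/imgE; apply: (lspan_gen (@tofrac A)
    (fun j => piL ^ (- gamma j) *: pm_inc M (e j))).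
Qed.

End AdaptedBasis.

(** One inclusion is read off the generators of [power_graded]. For the other, lifts in M \cap
    pi^(n_i) M' multiply to an element of pi^(n_1 + ... + n_k) S', and the filtration is
    decreasing. *)
Lemma power_hodge g : hodge_fil S g = power_fil (pp_fib P) (hodge_fil M) g.
Proof.
have [e [gamma ad]] := adapted_ex (erefl (pm_rank M)).
apply/subv_anti/andP; split.
  rewrite (hodge_fil_graded _ (power_graded ad)); apply/subv_sumP => h gh.
  rewrite -memvE; apply: (pspanP _).1.
  exists (fun i => gamma (h i)), [ffun i => pm_red M (e (h i))]; split=> [//|i|].
    rewrite ffunE (hodge_filE _ ad) memvE.
    by apply: (sumv_sup (h i)); rewrite ?subvv.
  rewrite -pp_fib_ext; congr (pp_fib P _).
  by apply/ffunP => i; rewrite !ffunE.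
apply: (pspanP _).2 => _ [n [x [gn Fx ->]]].
apply: (subvP (hodge_filS S gn)); apply/mem_hodge_fil.
have /choice[m mP] : forall i, exists m, x i = pm_red M m /\
    exists w, phi_image w /\ pm_inc M m = piL ^ n i *: w.
  move=> i; have /mem_hodge_fil[m [m' [mw ->]]] := Fx i; exists m; split=> //.
  by rewrite linearD redMZ red_pi scale0r addr0.
have /choice[w wP] := fun i => (mP i).2.
exists (pp_map P [ffun i => m i]), 0; split; last first.
  rewrite scaler0 addr0 -pp_fib_ext; congr (pp_fib P _).
  by apply/ffunP => i; rewrite !ffunE (mP i).1.
exists (pp_gen P [ffun i => w i]); split.
  by apply: pp_gen_image => i; rewrite ffunE; case: (wP i).
rewrite -pp_gen_ext -piL_sum -multilinear_scale; last exact: pp_gen_multilinear.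
by congr (pp_gen P _); apply/ffunP => i; rewrite !ffunE; case: (wP i).
Qed.

End OnePower.

End Powers.

(** * Tensor products and duals *)

Lemma bilinear_ex (A : comNzRingType) (M N W : lmodType A) (f : M -> N -> W) :
  (forall y, linear (f^~ y)) -> (forall x, linear (f x)) ->
  exists c : {bilinear M -> N -> W}, forall x y, c x y = f x y.
Proof.
move=> lin_l lin_r.
have bil_f : bilinear_for *:%R *:%R f by [].
pose c : {bilinear M -> N -> W} :=
  HB.pack f (bilinear_isBilinear.Build _ _ _ _ _ _ f bil_f).
by exists c.
Qed.

Lemma bilinear_span (A L : comNzRingType) (rho : {rmorphism A -> L})
    (M N T : lmodType L) (b : {bilinear M -> N -> T}) (I J : finType)
    (v : I -> M) (w : J -> N) (Q : T -> Prop) x y : submod_pred rho Q ->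
  (forall i j, Q (b (v i) (w j))) -> lspan rho v x -> lspan rho w y -> Q (b x y).
Proof.
move=> [Q0 QD] Qvw vx; move: y; apply: lspan_sub.
  by split=> [|a y z]; rewrite ?linear0r // linearPr; apply: QD.
move=> j; move: x vx; apply: lspan_sub => [|i]; last exact: Qvw.
by split=> [|a x y]; rewrite ?linear0l // linearPl; apply: QD.
Qed.

(** The retraction argument of [power_gen], with a bilinear map. *)
Lemma tensor_gen (A : comNzRingType) (M N T : lmodType A)
    (b : {bilinear M -> N -> T}) (U : submodule T) :
  is_tensor_product b -> (forall x y, U (b x y)) -> forall z, U z.
Proof.
move=> univ_b Ub.
have [||c cE] := @bilinear_ex _ _ _ (submodType U) (fun x y => to_submod (Ub x y)).
- by move=> y a x x'; apply: val_inj; rewrite [RHS]linearP; apply: linearPl.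
- by move=> x a y y'; apply: val_inj; rewrite [RHS]linearP; apply: linearPr.
have [f [fb _]] := univ_b _ c; have [g [_ g_uniq]] := univ_b _ b.
move=> z; suff -> : z = val (f z) by apply: submodTypeP.
rewrite -[RHS]/((val \o f) z) (g_uniq (val \o f)) => [|x y]; last first.
  by rewrite /= fb cE.
by rewrite -(g_uniq idfun).
Qed.

Section Tensor.

Variables (R : realType) (B : witt_base R) (M N T : phimod B).
Variable b : phi_tensor M N T.

Local Notation A := (wb_OL B).
Local Notation piL := (wb_piL B).

Lemma pt_gen_image v w : phi_image v -> phi_image w -> phi_image (pt_gen b v w).
Proof.
have [e basis_e] := pm_free M; have [f basis_f] := pm_free N.
move=> /(phi_image_span (basis_lspan basis_e)) Mv.
move=> /(phi_image_span (basis_lspan basis_f)) Nw.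
apply: (bilinear_span (phi_image_submod T) _ Mv Nw) => i j.
by rewrite -pt_phi pt_gen_ext; apply: phi_image_phi.
Qed.

Section AdaptedBases.

Variables (r s : nat) (e : 'I_r -> M) (f : 'I_s -> N).
Variables (gamma : 'I_r -> int) (delta : 'I_s -> int).
Hypotheses (ad_e : adapted e gamma) (ad_f : adapted f delta).

Local Notation eps := (fun ij : 'I_r * 'I_s => pt_map b (e ij.1) (f ij.2)).
Local Notation deg := (fun ij : 'I_r * 'I_s => gamma ij.1 + delta ij.2).

Lemma pt_gen_basis i j :
  pt_gen b (piL ^ (- gamma i) *: pm_inc M (e i)) (piL ^ (- delta j) *: pm_inc N (f j)) =
  piL ^ (- (gamma i + delta j)) *: pm_inc T (pt_map b (e i) (f j)).
Proof.
rewrite linearZl_LR linearZr_LR scalerA pt_gen_ext -expfzDr ?piL_neq0 //.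
by rewrite opprD.
Qed.

Lemma tensor_truncation g : exists p : {linear T -> T}, forall ij,
  p (eps ij) = if deg ij < g then eps ij else 0.
Proof.
have [/basis_coord[co [_ coE]] _] := ad_e.
have [/basis_coord[co' [_ coE']] _] := ad_f.
pose c x y : T := \sum_(ij | deg ij < g)
  (co ij.1 x * co' ij.2 y : A) *: pt_map b (e ij.1) (f ij.2).
have [||c' cE] := @bilinear_ex _ _ _ _ c.
- move=> y a x x'; rewrite scaler_sumr -big_split; apply: eq_bigr => ij _ /=.
  by rewrite linearP mulrDl scalerDl -mulrA scalerA.
- move=> x a y y'; rewrite scaler_sumr -big_split; apply: eq_bigr => ij _ /=.
  by rewrite linearP mulrDr scalerDl mulrCA scalerA.
have [p [pE _]] := pt_univ b c'.
exists p => -[i j]; rewrite pE cE /c /=.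
have coP k l : co k (e i) * co' l (f j) = ((k, l) == (i, j))%:R :> A.
  by rewrite coE coE' xpair_eqE -natrM mulnb.
case: ifP => dij; last first.
  rewrite big1 // => -[k l] dkl; rewrite coP; case: eqP => [kl|_].
    by rewrite kl /= dij in dkl.
  by rewrite scale0r.
rewrite (bigD1 (i, j)) //= coP eqxx scale1r big1 ?addr0 // => -[k l] /andP[_].
by rewrite coP => /negPf ->; rewrite scale0r.
Qed.

Lemma tensor_graded : graded_family eps deg.
Proof.
have [basis_e imgE] := ad_e; have [basis_f imgF] := ad_f.
have gen_eps z : lspan idfun eps z.
  pose U := Submodule (lspan_submod idfun eps).
  apply: (tensor_gen (U := U) (pt_univ b)) => x y.
  apply: (bilinear_span (lspan_submod idfun eps) _
    (basis_lspan basis_e x) (basis_lspan basis_f y)) => i j.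
  exact: (lspan_gen idfun eps (i, j)).
split=> // [w|[i j]|]; last exact: tensor_truncation.
- set Q := lspan _ _; have subQ : submod_pred (@tofrac A) Q by apply: lspan_submod.
  apply: phi_image_min => //.
  have subU : submod_pred idfun (fun m => Q (pm_phi T (pm_inc T m))).
    split=> [|a x y Qx Qy]; first by rewrite !linear0; case: subQ.
    by rewrite !linearP /= wb_frobL_ext; case: subQ => _; apply.
  apply: (tensor_gen (U := Submodule subU) (pt_univ b)) => x y /=.
  have /imgE Mx := phi_image_phi x; have /imgF Ny := phi_image_phi y.
  rewrite -pt_gen_ext pt_phi; apply: (bilinear_span subQ _ Mx Ny) => i j.
  rewrite pt_gen_basis.
  exact: (lspan_gen _ (fun ij => piL ^ (- deg ij) *: pm_inc T (eps ij)) (i, j)).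
- rewrite /= -pt_gen_basis; apply: pt_gen_image.
    apply/imgE; exact: (lspan_gen _ (fun i => piL ^ (- gamma i) *: pm_inc M (e i))).
  apply/imgF; exact: (lspan_gen _ (fun i => piL ^ (- delta i) *: pm_inc N (f i))).
Qed.

End AdaptedBases.

Lemma tensor_hodge g :
  hodge_fil T g = tensor_fil (pt_fib b) (hodge_fil M) (hodge_fil N) g.
Proof.
have [e [gamma ad_e]] := adapted_ex (erefl (pm_rank M)).
have [f [delta ad_f]] := adapted_ex (erefl (pm_rank N)).
apply/subv_anti/andP; split.
  rewrite (hodge_fil_graded _ (tensor_graded ad_e ad_f)); apply/subv_sumP => -[i j] gij.
  rewrite -memvE; apply: (pspanP _).1.
  (* The degrees must add up to g exactly. The surplus is taken from the first factor, where g -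
     delta_j <= gamma_i. *)
  exists (g - delta j), (delta j), (pm_red M (e i)), (pm_red N (f j)).
  rewrite subrK pt_fib_ext; split=> //.
    rewrite (hodge_filE _ ad_e) memvE; apply: (sumv_sup i); last exact: subvv.
    by rewrite lerBlDr.
  by rewrite (hodge_filE _ ad_f) memvE; apply: (sumv_sup j); rewrite ?subvv.
apply: (pspanP _).2 => _ [g1 [g2 [x [y [<- Fx Fy ->]]]]]; apply/mem_hodge_fil.
have [m [m' [[v [Mv mv]] ->]]] := (mem_hodge_fil _ _).1 Fx.
have [n [n' [[w [Nw nw]] ->]]] := (mem_hodge_fil _ _).1 Fy.
exists (pt_map b m n), 0; split; last first.
  rewrite scaler0 addr0 -pt_fib_ext.
  by congr (pt_fib b _ _); rewrite linearD redMZ red_pi scale0r addr0.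
exists (pt_gen b v w); split; first exact: pt_gen_image.
by rewrite -pt_gen_ext mv nw linearZl_LR linearZr_LR scalerA expfzDr ?piL_neq0.
Qed.

End Tensor.

Section Dual.

Variables (R : realType) (B : witt_base R) (M N : phimod B).
Variable d : phi_dual M N.

Local Notation A := (wb_OL B).
Local Notation L := (wb_L B).
Local Notation piL := (wb_piL B).

Variables (r : nat) (e : 'I_r -> M) (gamma : 'I_r -> int).
Hypothesis ad : adapted e gamma.

Lemma pd_map_inj y y' : (forall i, pd_map d (e i) y = pd_map d (e i) y') -> y = y'.
Proof.
move=> yy'; have [[gen_e _] _] := ad.
have [z [_ z_uniq]] := pd_univ d (applyr (pd_map d) y).
rewrite (z_uniq y) // (z_uniq y') // => x; have [c ->] := gen_e x.
rewrite -[RHS]/(pd_map d _ y) !linear_sumlz; apply: eq_bigr => i _.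
by rewrite !linearZl_LR yy'.
Qed.

Lemma dual_family : exists e' : 'I_r -> N, forall i j,
  pd_map d (e i) (e' j) = (i == j)%:R.
Proof.
have [/basis_coord[co [_ coE]] _] := ad.
have /choice[e' e'P] := fun j => pd_univ d (co j).
by exists e' => i j; have [-> _] := e'P j; rewrite coE eq_sym.
Qed.

(** On generators, the pairing of phi x with phi y is the Frobenius of an element of O_L. Thus N' is
    contained in the dual lattice of M'. *)
Lemma pd_gen_image v w : phi_image v -> phi_image w -> integral (pd_gen d v w).
Proof.
have [f basis_f] := pm_free N; have [basis_e _] := ad.
move=> /(phi_image_span (basis_lspan basis_e)) Mv.
move=> /(phi_image_span (basis_lspan basis_f)) Nw.
apply: (bilinear_span (Q := @integral R B : L^o -> Prop) _ _ Mv Nw) => [|i j].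
  split; first by exists 0; rewrite tofrac0.
  by move=> a _ _ [x ->] [y ->]; exists (a * x + y); rewrite tofracD tofracM.
by rewrite pd_phi pd_gen_ext wb_frobL_ext; exists (wb_frob B (pd_map d (e i) (f j))).
Qed.

(** N' is the whole dual lattice of M', as the phi(e_i) and phi(e'_j) are dual to each other.
    Dualizing the basis pi^(- gamma_i) e_i of M' gives the basis pi^(gamma_i) e'_i. *)
Lemma dual_adapted (e' : 'I_r -> N) :
  (forall i j, pd_map d (e i) (e' j) = (i == j)%:R) ->
  adapted e' (fun i => - gamma i).
Proof.
move=> dualE; have [basis_e imgE] := ad.
have pdE i (c : 'I_r -> A) : pd_map d (e i) (\sum_j c j *: e' j) = c i.
  rewrite linear_sumr (bigD1 i) //= linearZr_LR dualE eqxx.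
  rewrite big1 ?addr0 => [|j ji]; first exact: mulr1.
  by rewrite linearZr_LR dualE eq_sym (negPf ji) scaler0.
have basis_e' : is_basis e'.
  split=> [y|c c0 i]; last by rewrite -(pdE i c) c0 linear0r.
  by exists (fun i => pd_map d (e i) y); apply: pd_map_inj => i; rewrite pdE.
have pdgE i (c : 'I_r -> L) :
    pd_gen d (pm_inc M (e i)) (\sum_j c j *: pm_inc N (e' j)) = c i.
  rewrite linear_sumr (bigD1 i) //= linearZr_LR pd_gen_ext dualE eqxx.
  rewrite big1 ?addr0 => [|j ji]; first by rewrite tofrac1; apply: mulr1.
  by rewrite linearZr_LR pd_gen_ext dualE eq_sym (negPf ji) tofrac0 scaler0.
have phigE i (c : 'I_r -> L) :
    pd_gen d (pm_phi M (pm_inc M (e i))) (\sum_j c j *: pm_phi N (pm_inc N (e' j))) = c i.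
  rewrite linear_sumr (bigD1 i) //= linearZr_LR pd_phi pd_gen_ext dualE eqxx.
  rewrite big1 ?addr0 => [|j ji]; first by rewrite tofrac1 rmorph1; apply: mulr1.
  rewrite linearZr_LR pd_phi pd_gen_ext dualE eq_sym (negPf ji).
  by rewrite tofrac0 rmorph0 scaler0.
have imgei i : phi_image (piL ^ (- gamma i) *: pm_inc M (e i)).
  by apply/imgE; apply: (lspan_gen _ (fun i => piL ^ (- gamma i) *: pm_inc M (e i))).
split=> // w; split=> [Nw|].
  have [gen_ie _] := inc_basis basis_e'; have [c cE] := gen_ie w.
  (* The coordinate of w along e'_i is its pairing with e_i, and pi^(- gamma_i) e_i lies in M'. *)
  have /choice[a aE] : forall i, integral (piL ^ (- gamma i) * c i).
    move=> i; rewrite -(pdgE i c) -cE.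
    have := pd_gen_image (imgei i) Nw; by rewrite linearZl_LR.
  exists a; rewrite cE; apply: eq_bigr => i _.
  by rewrite /= -aE scalerA mulrAC -expfzDr ?piL_neq0 // opprK addNr expr0z mul1r.
apply: lspan_sub => [|i]; first exact: phi_image_submod.
apply/(phi_image_span (basis_lspan basis_e')).
have [gen_phi _] := phi_basis basis_e'; set u := _ *: _.
have [c cE] := gen_phi u.
(* The coordinate along phi(e'_j) is the pairing with phi(e_j), which is an integral combination of
   the pi^(- gamma_k) e_k. *)
suff /choice[a aE] : forall j, integral (c j).
  by exists a; rewrite cE; apply: eq_bigr => j _; rewrite aE.
move=> j; rewrite -(phigE j c) -cE.
have /imgE[a ->] := phi_image_phi (e j); exists (a i).
rewrite linear_sumlz (bigD1 i) //= big1 ?addr0 => [|k ki].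
  rewrite /u !linearZl_LR linearZr_LR pd_gen_ext dualE eqxx tofrac1 opprK.
  rewrite -[LHS]/(tofrac (a i) * (piL ^ (- gamma i) * (piL ^ gamma i * 1))).
  by rewrite mulr1 -expfzDr ?piL_neq0 // addNr expr0z mulr1.
rewrite /u !linearZl_LR linearZr_LR pd_gen_ext dualE (negPf ki) tofrac0.
by rewrite !scaler0.
Qed.

Lemma dual_hodge_adapted g :
  hodge_fil N g = dual_fil (pd_fib d) (hodge_fil M) g.
Proof.
have [e' dualE] := dual_family; have ad' := dual_adapted dualE.
have [basis_e' _] := ad'; have [basis_e _] := ad.
have pdfE i (c : 'I_r -> wb_F B) :
    pd_fib d (pm_red M (e i)) (\sum_j c j *: pm_red N (e' j)) = c i.
  rewrite linear_sumr (bigD1 i) //= linearZr_LR pd_fib_ext dualE eqxx.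
  rewrite big1 ?addr0 => [|j ji]; first by rewrite rmorph1; apply: mulr1.
  by rewrite linearZr_LR pd_fib_ext dualE eq_sym (negPf ji) rmorph0 scaler0.
rewrite (hodge_filE _ ad'); apply/subv_anti/andP; split.
  apply/subv_sumP => i gi; rewrite -memvE; apply: (pspanP _).1 => x.
  rewrite (hodge_filE _ ad) => /memv_sumP[xs xsP ->].
  rewrite linear_sumlz big1 // => j gj.
  have /vlineP[c ->] := xsP j gj; rewrite linearZl_LR pd_fib_ext dualE.
  case: eqP => [ji|_]; last by rewrite rmorph0 scaler0.
  (* If i = j, adding g <= - gamma_i and 1 - g <= gamma_i gives 1 <= 0. *)
  by move: (lerD gi gj); rewrite ji addrCA subrr addr0 addNr.
apply: (pspanP _).2 => y y0.
have : y \in fullv by rewrite memvf.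
rewrite -(red_full basis_e') => /memv_sumP[ys ysP].
have /choice[c cE] : forall j, exists c, ys j = c *: pm_red N (e' j).
  by move=> j; have /vlineP[c ->] := ysP j isT; exists c.
move=> yE; have {ys ysP cE}yE : y = \sum_i c i *: pm_red N (e' i).
  by rewrite yE; apply: eq_bigr.
rewrite yE (bigID (fun i => g <= - gamma i)) /= [X in _ + X]big1.
  by rewrite addr0; apply: memv_sumr => i _; apply/memvZ/memv_line.
(* Here gamma_i > - g, that is gamma_i >= 1 - g: the reduction of e_i lies in the step that y
   annihilates, and c_i is its pairing with y. *)
move=> i; rewrite -ltNge => gi; suff -> : c i = 0 by rewrite scale0r.
rewrite -(pdfE i c) -yE; apply: y0; rewrite (hodge_filE _ ad) memvE.
apply: (sumv_sup i); last exact: subvv.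
by rewrite ltrNl -lezD1 addrC in gi.
Qed.

End Dual.

Lemma dual_hodge (R : realType) (B : witt_base R) (M N : phimod B)
    (d : phi_dual M N) g : hodge_fil N g = dual_fil (pd_fib d) (hodge_fil M) g.
Proof.
have [e [gamma ad]] := adapted_ex (erefl (pm_rank M)).
exact: dual_hodge_adapted ad g.
Qed.

(** * Hodge types *)

Section Types.

Definition excess (n : int) (t : seq int) : int :=
  \sum_(x <- t) Num.max (x - n) 0.

Lemma excess_perm n s t : perm_eq s t -> excess n s = excess n t.
Proof. exact: perm_big. Qed.

Lemma ge_total : total (>=%R : rel int).
Proof. by move=> x y; apply: le_total. Qed.

Lemma ge_trans : transitive (>=%R : rel int).
Proof. by move=> y x z xy yz; apply: le_trans yz xy. Qed.

Lemma ge_anti : antisymmetric (>=%R : rel int).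
Proof. by move=> x y; rewrite andbC => /le_anti. Qed.

Lemma sum_shift (n : int) (s : seq int) :
  \sum_(x <- s) x = \sum_(x <- s) (x - n) + n *+ size s.
Proof.
elim: s => [|x s IH]; first by rewrite !big_nil mulr0n addr0.
by rewrite !big_cons IH mulrS addrACA subrK.
Qed.

(* The sum of the i largest entries x of s is at most i n plus the sum of the
   max(x - n, 0), with equality when n is the i-th entry. *)
Lemma type_le_excess (s t : seq int) :
  sorted >=%R s -> sorted >=%R t -> size s = size t ->
  \sum_(x <- s) x = \sum_(x <- t) x ->
  (forall n, excess n s <= excess n t) -> type_le s t.
Proof.
move=> sort_s sort_t size_st sum_st ex_st; split=> // -[|i] i_s.
  by rewrite !take0 !big_nil.
have i_t : (i < size t)%N by rewrite -size_st.
pose n := nth 0 t i.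
rewrite (sum_shift n (take _ s)) (sum_shift n (take _ t)) !size_takel // lerD2r.
have -> : \sum_(x <- take i.+1 t) (x - n) = excess n t.
  rewrite /excess -[in RHS](cat_take_drop i.+1 t) big_cat /=.
  rewrite [X in _ + X]big_seq [X in _ + X]big1 ?addr0 => [|x].
    apply: eq_big_seq => x /(nthP 0)[j]; rewrite size_takel // => ji <-.
    rewrite nth_take // max_l // subr_ge0.
    apply: (sorted_leq_nth ge_trans lexx 0 sort_t); rewrite ?inE //.
    exact: leq_ltn_trans i_t.
  case/(nthP 0) => j; rewrite size_drop ltn_subRL => jt <-.
  rewrite nth_drop; apply: max_r; rewrite subr_le0.
  apply: (sorted_leq_nth ge_trans lexx 0 sort_t); rewrite ?inE //.
  exact: leq_trans (leqnSn i) (leq_addr j i.+1).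
apply: le_trans (ex_st n).
rewrite /excess -[in leRHS](cat_take_drop i.+1 s) big_cat /= -[leLHS]addr0.
apply: lerD; last by apply: sumr_ge0 => x _; rewrite le_max lexx orbT.
by apply: ler_sum => x _; rewrite le_max lexx.
Qed.

Lemma count_geS (g : int) (s : seq int) :
  count (>= g) s = (count_mem g s + count (>= (g + 1)%R) s)%N.
Proof.
elim: s => //= x s ->; rewrite !addnA; congr (_ + _)%N.
rewrite addnAC; congr (_ + _)%N.
rewrite lezD1 lt_neqAle eq_sym.
by case: eqVneq => [->|_] //=; rewrite lexx.
Qed.

Lemma is_type_of_uniq (k : fieldType) (D : vectType k) (F : int -> {vspace D}) s t :
  is_type_of F s -> is_type_of F t -> s = t.
Proof.
move=> [sort_s cs] [sort_t ct]; apply: (sorted_eq ge_trans ge_anti) => //.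
by apply/allP => g _ /=; rewrite cs ct.
Qed.

End Types.

Section HodgeType.

Variables (R : realType) (B : witt_base R) (M : phimod B).

Lemma adapted_type r (e : 'I_r -> M) gamma : adapted e gamma ->
  is_type_of (hodge_fil M) (sort >=%R [seq gamma i | i <- enum 'I_r]).
Proof.
move=> ad; split; first exact: sort_sorted ge_total _.
move=> g; rewrite !(dim_hodge_fil _ ad) count_geS addnK.
by apply: (elimT seq.permP); rewrite perm_sort.
Qed.

(** An adapted basis provides a type, so [xget] does not fall back on its default. *)
Lemma hodge_typeP : is_type_of (hodge_fil M) (hodge_type M).
Proof.
have [e [gamma ad]] := adapted_ex (erefl (pm_rank M)).
apply: (@xgetPex _ [::] [set t | is_type_of (hodge_fil M) t]%classic).
by exists (sort >=%R [seq gamma i | i <- enum 'I_(pm_rank M)]); apply: adapted_type ad.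
Qed.

Lemma hodge_type_adapted r (e : 'I_r -> M) gamma : adapted e gamma ->
  perm_eq (hodge_type M) [seq gamma i | i <- enum 'I_r].
Proof.
move=> /adapted_type/(is_type_of_uniq hodge_typeP) ->.
by rewrite perm_sort.
Qed.

Lemma size_hodge_type : size (hodge_type M) = pm_rank M.
Proof.
have [e [gamma ad]] := adapted_ex (erefl (pm_rank M)).
by rewrite (perm_size (hodge_type_adapted ad)) size_map size_enum_ord.
Qed.

Lemma dim_hodge_fil_type g : \dim (hodge_fil M g) = count (>= g) (hodge_type M).
Proof.
have [e [gamma ad]] := adapted_ex (erefl (pm_rank M)).
by rewrite (dim_hodge_fil _ ad); have /seq.permP /(_ (>= g)) -> := hodge_type_adapted ad.
Qed.

Lemma sum_hodge_type r (e : 'I_r -> M) gamma (F : int -> int) : adapted e gamma ->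
  \sum_(x <- hodge_type M) F x = \sum_i F (gamma i).
Proof.
by move=> ad; rewrite (perm_big _ (hodge_type_adapted ad)) big_map big_enum.
Qed.

End HodgeType.

(** * The lattices M + pi^n M' *)

Section SumLattice.

Variables (R : realType) (B : witt_base R) (M : phimod B) (r : nat).
Variables (e : 'I_r -> M) (gamma : 'I_r -> int).
Hypothesis ad : adapted e gamma.

Local Notation A := (wb_OL B).
Local Notation piL := (wb_piL B).

(** Along e_i the lattice M + pi^n M' is O_L + pi^(n - gamma_i) O_L, generated by the smaller power
    of pi. *)
Definition lattice_exp (n : int) (i : 'I_r) : int := Num.min 0 (n - gamma i).

(* A basis of the lattice M + pi^n M'. *)
Definition sum_lattice (n : int) (i : 'I_r) : pm_gen M :=
  piL ^ lattice_exp n i *: pm_inc M (e i).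

(** Each basis vector lies in one of the two summands, so that maps and lifts can be treated on M
    and on pi^n M' separately. *)
Lemma sum_latticeP n i : sum_lattice n i = pm_inc M (e i) \/
  exists w, phi_image w /\ sum_lattice n i = piL ^ n *: w.
Proof.
rewrite /sum_lattice /lattice_exp; case: leP => ni.
  by left; rewrite expr0z scale1r.
right; exists (piL ^ (- gamma i) *: pm_inc M (e i)); split.
  by have [_ imgE] := ad; apply/imgE;
     apply: (lspan_gen _ (fun i => piL ^ (- gamma i) *: pm_inc M (e i))).
by rewrite scalerA -expfzDr ?piL_neq0.
Qed.

Lemma sum_lattice_coeff n z i : lattice_exp n i <= z ->
  lspan (@tofrac A) (sum_lattice n) (piL ^ z *: pm_inc M (e i)).
Proof.
rewrite -subr_ge0 => /(@integral_pi _ B)[a aE].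
have -> : piL ^ z *: pm_inc M (e i) = tofrac a *: sum_lattice n i.
  by rewrite -aE scalerA -expfzDr ?piL_neq0 // subrK.
exact: submodZ (lspan_submod _ _) (lspan_gen _ _ i).
Qed.

Lemma sum_lattice_inc n m : lspan (@tofrac A) (sum_lattice n) (pm_inc M m).
Proof.
have [basis_e _] := ad; have [a ->] := basis_lspan basis_e m.
rewrite inc_lincomb; apply: submod_sum => [|i _]; first exact: lspan_submod.
rewrite -[pm_inc M _]scale1r -(expr0z piL); apply: sum_lattice_coeff.
by rewrite ge_min lexx.
Qed.

Lemma sum_lattice_image n w : phi_image w ->
  lspan (@tofrac A) (sum_lattice n) (piL ^ n *: w).
Proof.
have [_ imgE] := ad; case/imgE => a ->; rewrite scaler_sumr.
under eq_bigr do rewrite scalerA mulrC -scalerA.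
apply: submod_sum => [|i _]; first exact: lspan_submod.
rewrite scalerA -expfzDr ?piL_neq0 //; apply: sum_lattice_coeff.
by rewrite ge_min lexx orbT.
Qed.

Lemma sum_lattice_mxact n : sum_lattice n =
  mxact (diag_mx (\row_i piL ^ lattice_exp n i)) (fun i => pm_inc M (e i)).
Proof.
apply: funext => i; rewrite /mxact (bigD1 i) //= big1 => [|j ji].
  by rewrite !mxE eqxx mulr1n addr0.
by rewrite !mxE eq_sym (negPf ji) mulr0n scale0r.
Qed.

Lemma det_sum_lattice n :
  \det (diag_mx (\row_i piL ^ lattice_exp n i)) = piL ^ (\sum_i lattice_exp n i).
Proof. by rewrite det_diag -piL_sum; apply: eq_bigr => i _; rewrite mxE. Qed.

Lemma sum_lattice_free n (a : 'I_r -> A) :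
  \sum_i tofrac (a i) *: sum_lattice n i = 0 -> forall i, a i = 0.
Proof.
have [/inc_basis[_ free_ie] _] := ad => a0 i.
have /eqP : tofrac (a i) * piL ^ lattice_exp n i = 0.
  apply: (free_ie (fun i => tofrac (a i) * piL ^ lattice_exp n i)).
  by rewrite -[RHS]a0; apply: eq_bigr => j _; rewrite scalerA.
rewrite mulf_eq0 tofrac_eq0 => /orP[/eqP //|].
by rewrite (negPf (expfz_neq0 _ (piL_neq0 B))).
Qed.

Lemma excess_hodge_type n :
  excess n (hodge_type M) = - \sum_i lattice_exp n i.
Proof.
rewrite /excess (sum_hodge_type _ ad) -sumrN; apply: eq_bigr => i _.
by rewrite /lattice_exp oppr_min oppr0 opprB maxC.
Qed.

(** For such n the determinant of M + pi^n M' gives access to the total of the type. *)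
Lemma lattice_exp_small n : (forall i, n <= gamma i) ->
  \sum_i lattice_exp n i = n *+ r - \sum_i gamma i.
Proof.
move=> small; rewrite -[in n *+ r](card_ord r) -sumr_const -sumrB.
by apply: eq_bigr => i _; apply: min_r; rewrite subr_le0.
Qed.

End SumLattice.

(** * Exact sequences *)

Section JoinFamilies.

Variables (T : Type) (m n : nat) (u : 'I_m -> T) (v : 'I_n -> T).

Definition join_fam (k : 'I_(m + n)) : T :=
  match split k with inl i => u i | inr j => v j end.

Lemma join_faml i : join_fam (lshift n i) = u i.
Proof. by rewrite /join_fam (unsplitK (inl i)). Qed.

Lemma join_famr j : join_fam (rshift m j) = v j.
Proof. by rewrite /join_fam (unsplitK (inr j)). Qed.

Lemma join_famP (Q : T -> Prop) :
  (forall i, Q (u i)) -> (forall j, Q (v j)) -> forall k, Q (join_fam k).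
Proof. by move=> Qu Qv k; rewrite /join_fam; case: split. Qed.

End JoinFamilies.

Lemma sum_join_fam (A : nzRingType) (V : lmodType A) m n (u : 'I_m -> V)
    (v : 'I_n -> V) (c : 'I_(m + n) -> A) :
  \sum_k c k *: join_fam u v k =
  \sum_i c (lshift n i) *: u i + \sum_j c (rshift m j) *: v j.
Proof.
rewrite big_split_ord; congr (_ + _); apply: eq_bigr => i _.
  by rewrite join_faml.
by rewrite join_famr.
Qed.

Lemma lspan_mxactP (A L : comUnitRingType) (rho : {rmorphism A -> L})
    (V : lmodType L) m n (t : 'I_m -> V) (w : 'I_n -> V) :
  (forall k, lspan rho w (t k)) -> exists X : 'M[A]_(m, n), t = mxact (map_mx rho X) w.
Proof.
move=> /choice[a aE]; exists (\matrix_(i, j) a i j); apply: funext => i.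
by rewrite aE; apply: eq_bigr => j _; rewrite !mxE.
Qed.

(** * Comparison of lattices by determinants *)

Section LatticeIndex.

Variables (R : realType) (B : witt_base R) (V : lmodType (wb_L B)) (r : nat).
Variables (v v' : 'I_r -> V) (X : 'M[wb_OL B]_r) (D D' : 'M[wb_L B]_r).
Variables (d d' : int).

Local Notation A := (wb_OL B).
Local Notation L := (wb_L B).
Local Notation piL := (wb_piL B).
Local Notation "X ^F" := (map_mx (@tofrac A) X) (at level 2, format "X ^F").

Hypotheses (basis_v : is_basis v) (UX : X \in unitmx) (v'X : v' = mxact X^F v).
Hypotheses (detD : \det D = piL ^ d) (detD' : \det D' = piL ^ d').

Local Notation w := (mxact D v).
Local Notation w' := (mxact D' v').

(** Write w' = Y w with Y integral. As X is invertible over O_L, the valuation of det Y is d' - d;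
    if it is 0 then Y is invertible and the lattices coincide. *)
Lemma lattice_index_le : (forall k, lspan (@tofrac A) w (w' k)) ->
  d <= d' /\ (d' = d -> forall k, lspan (@tofrac A) w' (w k)).
Proof.
case/lspan_mxactP => Y; rewrite v'X -!mxactM => /(mxact_inj basis_v) YE.
have := congr1 determinant YE; rewrite !det_mulmx !det_map_mx detD detD'.
have UdX : \det X \is a GRing.unit by rewrite -unitmxE.
rewrite -[piL ^ d]mulr1 -tofrac1.
case/(unit_mul_pi UdX (unitr1 _)) => dd' eq_dd'; split=> // /eq_dd' UY k.
have {}UY : Y \in unitmx by rewrite unitmxE.
apply/(@lspan_mxact_sub _ _ _ _ _ _ (invmx Y)).
rewrite -!mxactM YE mulmxA -map_mxM mulVmx // map_mx1 mul1mx.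
exact: lspan_gen.
Qed.

Lemma lattice_index_ge : (forall k, lspan (@tofrac A) w' (w k)) -> d' <= d.
Proof.
case/lspan_mxactP => Y; rewrite v'X -!mxactM => /(mxact_inj basis_v) YE.
have := congr1 determinant YE; rewrite !det_mulmx !det_map_mx detD detD'.
have UdX : \det X \is a GRing.unit by rewrite -unitmxE.
rewrite -[piL ^ d]mulr1 -tofrac1.
by rewrite -mulrA => /(unit_mul_pi (unitr1 _) UdX)[].
Qed.

End LatticeIndex.

Section ExactSequence.

Variables (R : realType) (B : witt_base R) (M1 M2 M3 : phimod B).
Variables (f : phihom M1 M2) (h : phihom M2 M3).
Hypothesis exact_fh : phi_short_exact f h.

Local Notation A := (wb_OL B).
Local Notation L := (wb_L B).
Local Notation pi := (wb_piOL B).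
Local Notation piL := (wb_piL B).
Local Notation "X ^F" := (map_mx (@tofrac A) X) (at level 2, format "X ^F").

Lemma hf0 x : h (f x) = 0.
Proof. by have [_ ker_h _] := exact_fh; apply/ker_h; exists x. Qed.

Lemma ph_gen_comp0 v : ph_gen h (ph_gen f v) = 0.
Proof.
have [a [m [a0 av]]] := pm_inc_frac v.
have ta0 : tofrac a != 0 by rewrite tofrac_eq0.
rewrite -[v]scale1r -(mulVf ta0) -scalerA av.
by rewrite !linearZ /= !ph_gen_ext hf0 linear0 scaler0.
Qed.

Lemma ph_gen_inj v : ph_gen f v = 0 -> v = 0.
Proof.
have [inj_f _ _] := exact_fh.
have [a [m [a0 av]]] := pm_inc_frac v.
have ta0 : tofrac a != 0 by rewrite tofrac_eq0.
rewrite -[v]scale1r -(mulVf ta0) -scalerA av linearZ /= ph_gen_ext => fm0.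
suff -> : m = 0 by rewrite linear0 scaler0.
apply: inj_f; apply: (@pm_inc_inj _ _ M2); rewrite !linear0.
by rewrite -[LHS]scale1r -(divff ta0) -scalerA fm0 scaler0.
Qed.

(** M_3 is torsion free, so f(M_1) is saturated in M_2: f x = pi y forces h y = 0, and y comes from
    M_1. *)
Lemma ph_fib_inj d : ph_fib f d = 0 -> d = 0.
Proof.
have [inj_f ker_h _] := exact_fh.
have [x <-] := pm_red_surj d; rewrite ph_fib_ext => /pm_red_ker[y fxy].
have hy0 : h y = 0.
  apply: (torsion_free (pi_neq0 B)).
  by rewrite -linearZ -fxy hf0 scaler0.
have /ker_h[x' fx'] := hy0.
apply/pm_red_ker; exists x'; apply: inj_f.
by rewrite linearZ /= fx'.
Qed.

(** If h y = pi z, subtract from y the multiple by pi of a lift of z; the reduction does not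
    change. *)
Lemma ph_fib_ker d : ph_fib h d = 0 -> exists x, d = pm_red M2 (f x).
Proof.
have [_ ker_h surj_h] := exact_fh.
have [y <-] := pm_red_surj d; rewrite ph_fib_ext => /pm_red_ker[z hyz].
have [y' hy'] := surj_h z.
have /ker_h[x fx] : h (y - pi *: y') = 0.
  by rewrite linearB linearZ /= hy' hyz subrr.
exists x; rewrite fx linearB redMZ red_pi scale0r.
by rewrite subr0.
Qed.

Lemma phi_image_lift w : phi_image w ->
  exists w', phi_image w' /\ ph_gen h w' = w.
Proof.
have [_ _ surj_h] := exact_fh; move: w; apply: phi_image_min.
  split=> [|a _ _ [x [Mx <-]] [y [My <-]]].
    by exists 0; split; [case: (phi_image_submod M2) | rewrite linear0].
  exists (tofrac a *: x + y); split; last by rewrite linearP.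
  by case: (phi_image_submod M2) => _; apply.
move=> z; have [y hy] := surj_h z; exists (pm_phi M2 (pm_inc M2 y)).
by rewrite ph_phi ph_gen_ext hy; split=> //; apply: phi_image_phi.
Qed.

Variables (r1 r3 : nat) (e1 : 'I_r1 -> M1) (e3 : 'I_r3 -> M3).
Variables (gamma1 : 'I_r1 -> int) (gamma3 : 'I_r3 -> int).
Hypotheses (ad1 : adapted e1 gamma1) (ad3 : adapted e3 gamma3).

Section LiftedBasis.

Variable l : 'I_r3 -> M2.
Hypothesis hl : forall j, h (l j) = e3 j.

Local Notation E := (join_fam (fun i => f (e1 i)) l).

Lemma lifted_basis : is_basis E.
Proof.
have [inj_f ker_h surj_h] := exact_fh.
have [[gen1 free1] _] := ad1; have [[gen3 free3] _] := ad3.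
split=> [y|c].
  have [b hy] := gen3 (h y).
  have /ker_h[x fx] : h (y - \sum_j b j *: l j) = 0.
    rewrite linearB linear_sum hy; apply/eqP; rewrite subr_eq0; apply/eqP.
    by apply: eq_bigr => j _; rewrite linearZ /= hl.
  have [a xE] := gen1 x; exists (join_fam a b).
  rewrite sum_join_fam; apply/eqP; rewrite -subr_eq; apply/eqP.
  under eq_bigr do rewrite join_famr.
  rewrite -fx xE linear_sum; apply: eq_bigr => i _.
  by rewrite join_faml linearZ.
rewrite sum_join_fam => c0.
have c3 : forall j, c (rshift r1 j) = 0.
  apply: (free3 (fun j => c (rshift r1 j))).
  have := congr1 h c0; rewrite linearD linear0 !linear_sum big1 ?add0r => [hc0|i _].
    by rewrite -[RHS]hc0; apply: eq_bigr => j _; rewrite linearZ /= hl.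
  by rewrite linearZ /= hf0 scaler0.
have c1 : forall i, c (lshift r3 i) = 0.
  apply: (free1 (fun i => c (lshift r3 i))); apply: inj_f.
  rewrite linear0 -c0 [X in _ = _ + X]big1 ?addr0 => [|j _]; last by rewrite c3 scale0r.
  by rewrite linear_sum; apply: eq_bigr => i _; rewrite linearZ.
by move=> k; case: (split_ordP k) => i ->.
Qed.

(** The images under phi of the vectors of E generate M_2'. Those of the l_j map to the independent
    vectors phi(e3_j), so in an element of the kernel only the part coming from M_1' remains. *)
Lemma phi_image_ker w : phi_image w -> ph_gen h w = 0 ->
  exists w1, phi_image w1 /\ w = ph_gen f w1.
Proof.
have basis_E := lifted_basis; have [basis3 _] := ad3.
move=> /(phi_image_span (basis_lspan basis_E))[a ->]; rewrite big_split_ord.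
have hE0 : forall i, ph_gen h (pm_phi M2 (pm_inc M2 (E (lshift r3 i)))) = 0.
  by move=> i; rewrite join_faml -ph_gen_ext -ph_phi ph_gen_comp0.
rewrite /= linearD !linear_sum [X in X + _ = 0]big1 ?add0r => [|i _]; last first.
  by rewrite linearZ /= hE0 scaler0.
case: (phi_basis basis3) => _ free3 hw0.
have a0 j : tofrac (a (rshift r1 j)) = 0.
  apply: (free3 (fun j => tofrac (a (rshift r1 j)))); rewrite -[RHS]hw0.
  by apply: eq_bigr => k _; rewrite linearZ /= join_famr ph_phi ph_gen_ext hl.
exists (\sum_i tofrac (a (lshift r3 i)) *: pm_phi M1 (pm_inc M1 (e1 i))); split.
  apply: submod_sum => [|i _]; first exact: phi_image_submod.
  exact: phi_image_phi.
rewrite [X in _ + X]big1 ?addr0 => [|j _]; last by rewrite /= a0 scale0r.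
rewrite linear_sum; apply: eq_bigr => i _.
by rewrite linearZ /= ph_phi ph_gen_ext join_faml.
Qed.

Section MiddleLattice.

Variables (e2 : 'I_(r1 + r3) -> M2) (gamma2 : 'I_(r1 + r3) -> int).
Hypothesis ad2 : adapted e2 gamma2.
Variable n : int.

Local Notation u1 := (sum_lattice e1 gamma1 n).
Local Notation u2 := (sum_lattice e2 gamma2 n).
Local Notation u3 := (sum_lattice e3 gamma3 n).

(** A generator of N_3 lies in M_3 or in pi^n M_3', and either summand lifts to M_2. *)
Lemma sum_lattice_lift j : exists z, lspan (@tofrac A) u2 z /\ ph_gen h z = u3 j.
Proof.
have [->|[w [Mw ->]]] := sum_latticeP ad3 n j.
  exists (pm_inc M2 (l j)); rewrite ph_gen_ext hl; split=> //.
  exact: sum_lattice_inc.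
have [w' [Mw' <-]] := phi_image_lift Mw.
by exists (piL ^ n *: w'); rewrite linearZ; split=> //; apply: sum_lattice_image.
Qed.

Variable z : 'I_r3 -> pm_gen M2.
Hypotheses (z_in : forall j, lspan (@tofrac A) u2 (z j))
           (hz : forall j, ph_gen h (z j) = u3 j).

Local Notation t := (join_fam (fun i => ph_gen f (u1 i)) z).

Lemma join_in_middle k : lspan (@tofrac A) u2 (t k).
Proof.
apply: join_famP k => // i; have [->|[w [Mw ->]]] := sum_latticeP ad1 n i.
  by rewrite ph_gen_ext; apply: sum_lattice_inc.
by rewrite linearZ; apply: sum_lattice_image => //; apply: ph_gen_image.
Qed.

(* In the basis E the family t has a block triangular matrix. *)
Lemma join_mxact : exists2 T, t = mxact T (fun k => pm_inc M2 (E k)) &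
  \det T = piL ^ (\sum_i lattice_exp gamma1 n i + \sum_j lattice_exp gamma3 n j).
Proof.
have [gen_iE _] := inc_basis lifted_basis.
have [c cE] := choice (fun j => gen_iE (z j)).
have [basis3 _] := ad3; have [_ free3] := inc_basis basis3.
pose d3 := \row_j piL ^ lattice_exp gamma3 n j.
pose d1 := \row_i piL ^ lattice_exp gamma1 n i.
(* Applying h to the expansion of z_j in E leaves the coordinates of the generator u3_j of N_3. *)
have c3 j k : c j (rshift r1 k) = diag_mx d3 j k.
  apply/eqP; rewrite -subr_eq0; apply/eqP.
  apply: (free3 (fun k => c j (rshift r1 k) - diag_mx d3 j k)).
  under eq_bigr do rewrite scalerBl; rewrite sumrB.
  apply/eqP; rewrite subr_eq0; apply/eqP.
  rewrite -[RHS]/(mxact (diag_mx d3) (fun k => pm_inc M3 (e3 k)) j).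
  rewrite -sum_lattice_mxact -hz cE big_split_ord /= linearD !linear_sum.
  rewrite [X in _ = X + _]big1 ?add0r => [|i _].
    by apply: eq_bigr => i _; rewrite linearZ /= join_famr ph_gen_ext hl.
  by rewrite linearZ /= join_faml ph_gen_ext hf0 linear0 scaler0.
exists (block_mx (diag_mx d1) 0 (\matrix_(j, i) c j (lshift r3 i)) (diag_mx d3)).
  apply: funext => k; rewrite /mxact big_split_ord /=.
  case: (split_ordP k) => i ->.
    rewrite join_faml (sum_lattice_mxact e1 gamma1 n) linear_sum.
    rewrite [X in _ = _ + X]big1 ?addr0 => [|j _].
      apply: eq_bigr => j _.
      by rewrite block_mxEul linearZ /= join_faml ph_gen_ext.
    by rewrite block_mxEur mxE scale0r.
  rewrite join_famr cE big_split_ord; congr (_ + _); apply: eq_bigr => j _.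
    by rewrite block_mxEdl mxE.
  by rewrite block_mxEdr c3.
rewrite det_lblock expfzDr ?piL_neq0 //; congr (_ * _).
  exact: det_sum_lattice.
exact: det_sum_lattice.
Qed.

(** The family t generates an extension of N_3 by N_1 inside N_2. As E and e2 are bases of the same
    M_2, its determinant can be compared with that of N_2, and equality makes the two lattices
    coincide. *)
Lemma middle_lattice_le :
  \sum_k lattice_exp gamma2 n k <=
    \sum_i lattice_exp gamma1 n i + \sum_j lattice_exp gamma3 n j /\
  (\sum_i lattice_exp gamma1 n i + \sum_j lattice_exp gamma3 n j =
    \sum_k lattice_exp gamma2 n k -> forall k, lspan (@tofrac A) t (u2 k)).
Proof.
have [basis2 _] := ad2; have [X UX EX] := basis_change basis2 lifted_basis.
have iEX : (fun k => pm_inc M2 (E k)) = mxact X^F (fun k => pm_inc M2 (e2 k)).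
  by rewrite EX inc_mxact.
have [T tT detT] := join_mxact; have := join_in_middle.
rewrite tT (sum_lattice_mxact e2) => tu2.
exact: lattice_index_le (inc_basis basis2) UX iEX (det_sum_lattice _ _ _) detT tu2.
Qed.

Lemma middle_lattice_ge : (forall k, lspan (@tofrac A) t (u2 k)) ->
  \sum_i lattice_exp gamma1 n i + \sum_j lattice_exp gamma3 n j <=
    \sum_k lattice_exp gamma2 n k.
Proof.
have [basis2 _] := ad2; have [X UX EX] := basis_change basis2 lifted_basis.
have iEX : (fun k => pm_inc M2 (E k)) = mxact X^F (fun k => pm_inc M2 (e2 k)).
  by rewrite EX inc_mxact.
have [T tT detT] := join_mxact.
rewrite tT (sum_lattice_mxact e2) => u2t.
exact: lattice_index_ge (inc_basis basis2) UX iEX (det_sum_lattice _ _ _) detT u2t.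
Qed.

(** Applying h kills the part coming from N_1 and sends the z_j to the independent u3_j, so their
    coefficients vanish. *)
Lemma join_kernel w : lspan (@tofrac A) t (ph_gen f w) -> lspan (@tofrac A) u1 w.
Proof.
case=> a; rewrite sum_join_fam => wE.
have a0 : forall j, a (rshift r1 j) = 0.
  apply: (sum_lattice_free ad3 (n := n) (a := fun j => a (rshift r1 j))).
  have := congr1 (ph_gen h) wE; rewrite ph_gen_comp0 linearD !linear_sum.
  rewrite [X in X + _]big1 ?add0r => [hw|i _]; last first.
    by rewrite linearZ /= ph_gen_comp0 scaler0.
  by rewrite [RHS]hw; apply: eq_bigr => j _; rewrite [in RHS]linearZ /= hz.
exists (fun i => a (lshift r3 i)); apply/eqP; rewrite -subr_eq0; apply/eqP.
apply: ph_gen_inj; rewrite linearB wE [X in _ + X - _]big1 ?addr0 => [|j _].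
  rewrite linear_sum; apply/eqP; rewrite subr_eq0; apply/eqP/eq_bigr => i _.
  by rewrite [in RHS]linearZ.
by rewrite /= a0 tofrac0 scale0r.
Qed.

(* When n is at most every gamma the lattice M + pi^n M' is just pi^n M'. *)
Lemma image_in_join : (forall i, n <= gamma1 i) -> (forall j, n <= gamma3 j) ->
  (forall k, n <= gamma2 k) -> forall k, lspan (@tofrac A) t (u2 k).
Proof.
move=> small1 small3 small2.
have smallE M r (e : 'I_r -> pm_mod M) gamma (i : 'I_r) : n <= gamma i ->
    sum_lattice e gamma n i = piL ^ n *: (piL ^ (- gamma i) *: pm_inc M (e i)).
  move=> ni; rewrite /sum_lattice /lattice_exp min_r ?subr_le0 //.
  by rewrite scalerA -expfzDr ?piL_neq0.
have [_ img1] := ad1; have [_ img2] := ad2; have [_ img3] := ad3.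
suff in_t w : phi_image w -> lspan (@tofrac A) t (piL ^ n *: w).
  move=> k; rewrite smallE //; apply: in_t; apply/img2.
  exact: (lspan_gen _ (fun k => piL ^ (- gamma2 k) *: pm_inc M2 (e2 k))).
move=> Mw; have /img3[b hwE] := ph_gen_image h Mw.
(* The vectors pi^(-n) z_j lie in M_2' and lift the generators pi^(- gamma_j) e3_j of M_3'.
   Subtracting a combination of them from w leaves an element of M_2' killed by h, to which
   [phi_image_ker] applies. *)
have z_img j : phi_image (piL ^ (- n) *: z j).
  have [a zE] := z_in j; apply/img2; exists a; rewrite zE scaler_sumr.
  apply: eq_bigr => k _; rewrite smallE // !scalerA; congr (_ *: _).
  by rewrite mulrACA -expfzDr ?piL_neq0 // addNr expr0z mul1r.
have [||w1 [Mw1 wE]] := @phi_image_ker (w - \sum_j tofrac (b j) *: (piL ^ (- n) *: z j)).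
- apply: submodB; [exact: phi_image_submod | by [] |].
  by apply: submod_sum => [|j _]; [exact: phi_image_submod | exact: z_img].
- rewrite linearB hwE linear_sum; apply/eqP; rewrite subr_eq0; apply/eqP.
  apply: eq_bigr => j _; rewrite !linearZ /= hz smallE // !scalerA; congr (_ *: _).
  rewrite [LHS]mulrC -!mulrA; congr (_ * _).
  by rewrite mulrA -expfzDr ?piL_neq0 // addNr expr0z mul1r.
have -> : w = ph_gen f w1 + \sum_j tofrac (b j) *: (piL ^ (- n) *: z j).
  by rewrite -wE subrK.
rewrite scalerDr; apply: submodD; first exact: lspan_submod.
  have /img1[a ->] := Mw1; rewrite linear_sum scaler_sumr.
  have phgZ c v : ph_gen f (c *: v) = c *: ph_gen f v by apply: linearZ.
  under eq_bigr do rewrite phgZ scalerA mulrC -scalerA -phgZ -smallE //.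
  apply: submod_sum => [|i _]; first exact: lspan_submod.
  have := lspan_gen (@tofrac A) t (lshift r3 i).
  by rewrite join_faml.
rewrite scaler_sumr; under eq_bigr do rewrite scalerA mulrC -scalerA.
apply: submod_sum => [|j _]; first exact: lspan_submod.
rewrite scalerA -expfzDr ?piL_neq0 // subrr.
rewrite expr0z scale1r; have := lspan_gen (@tofrac A) t (rshift r1 j).
by rewrite join_famr.
Qed.

End MiddleLattice.

End LiftedBasis.

End ExactSequence.

(** * Types in an exact sequence, and the case of equality *)

Section ExactTypes.

Variables (R : realType) (B : witt_base R) (M1 M2 M3 : phimod B).
Variables (f : phihom M1 M2) (h : phihom M2 M3).
Hypothesis exact_fh : phi_short_exact f h.

Local Notation A := (wb_OL B).
Local Notation pi := (wb_piOL B).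
Local Notation piL := (wb_piL B).

Section AdaptedBases.

Variables (r1 r3 : nat) (e1 : 'I_r1 -> M1) (e3 : 'I_r3 -> M3).
Variables (e2 : 'I_(r1 + r3) -> M2) (l : 'I_r3 -> M2).
Variables (gamma1 : 'I_r1 -> int) (gamma3 : 'I_r3 -> int).
Variable gamma2 : 'I_(r1 + r3) -> int.
Hypotheses (ad1 : adapted e1 gamma1) (ad3 : adapted e3 gamma3).
Hypotheses (ad2 : adapted e2 gamma2) (hl : forall j, h (l j) = e3 j).

Lemma excess_exact n :
  excess n (hodge_type M1) + excess n (hodge_type M3) <= excess n (hodge_type M2) /\
  (excess n (hodge_type M1) + excess n (hodge_type M3) = excess n (hodge_type M2) ->
   forall w, lspan (@tofrac A) (sum_lattice e2 gamma2 n) (ph_gen f w) ->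
     lspan (@tofrac A) (sum_lattice e1 gamma1 n) w).
Proof.
have /choice[z zP] := sum_lattice_lift exact_fh ad3 hl ad2 n.
have z_in j := (zP j).1; have hz j := (zP j).2.
have [le_t eq_t] := middle_lattice_le exact_fh ad1 ad3 hl ad2 z_in hz.
rewrite (excess_hodge_type ad1) (excess_hodge_type ad2) (excess_hodge_type ad3).
rewrite -opprD lerN2; split=> // /oppr_inj/eq_t u2t w u2w.
apply: (join_kernel exact_fh ad3 hz).
by apply: lspan_sub u2t _ u2w; apply: lspan_submod.
Qed.

(** For n below all the gammas both index inequalities hold. Equality then compares n r_i minus the
    total of each type, and the multiples of n cancel because r_2 = r_1 + r_3. *)
Lemma sum_type_exact :
  \sum_(x <- hodge_type M1) x + \sum_(x <- hodge_type M3) x =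
  \sum_(x <- hodge_type M2) x.
Proof.
have [N1 N1P] := integer_bound gamma1; have [N2 N2P] := integer_bound gamma2.
have [N3 N3P] := integer_bound gamma3.
pose n : int := - (N1 + N2 + N3)%N%:Z.
have small (g : int) (N : nat) : `|g| <= N%:Z -> (N <= N1 + N2 + N3)%N -> n <= g.
  move=> gN NN; rewrite lerNl; apply: le_trans (ler_norm _) _; rewrite normrN.
  by apply: le_trans gN _; rewrite lez_nat.
have small1 i : n <= gamma1 i.
  by apply: small (N1P i) _; rewrite -addnA leq_addr.
have small2 i : n <= gamma2 i.
  by apply: small (N2P i) _; rewrite addnAC leq_addl.
have small3 i : n <= gamma3 i by apply: small (N3P i) _; rewrite leq_addl.
have /choice[z zP] := sum_lattice_lift exact_fh ad3 hl ad2 n.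
have z_in j := (zP j).1; have hz j := (zP j).2.
have [le_t _] := middle_lattice_le exact_fh ad1 ad3 hl ad2 z_in hz.
have := middle_lattice_ge exact_fh ad1 ad3 hl ad2 hz.
move=> /(_ (image_in_join exact_fh ad1 ad3 hl ad2 z_in hz small1 small3 small2)).
move=> ge_t; have /eqP := le_anti (introT andP (conj ge_t le_t)).
rewrite (sum_hodge_type id ad1) (sum_hodge_type id ad2) (sum_hodge_type id ad3).
rewrite !lattice_exp_small // addrACA -mulrnDr -opprD (inj_eq (addrI _)).
by rewrite eqr_opp => /eqP.
Qed.

Lemma type_concat_perm (s t : seq int) : perm_eq (type_concat s t) (s ++ t).
Proof. by rewrite perm_sort. Qed.

Lemma type_le_exact :
  type_le (type_concat (hodge_type M1) (hodge_type M3)) (hodge_type M2).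
Proof.
have excessE n : excess n (type_concat (hodge_type M1) (hodge_type M3)) =
    excess n (hodge_type M1) + excess n (hodge_type M3).
  by rewrite (excess_perm n (type_concat_perm _ _)) /excess big_cat.
apply: type_le_excess.
- exact: sort_sorted ge_total _.
- by have [] := hodge_typeP M2.
- rewrite size_sort size_cat !size_hodge_type.
  have [basis1 _] := ad1; have [basis2 _] := ad2; have [basis3 _] := ad3.
  by rewrite (rank_basis basis1) (rank_basis basis2) (rank_basis basis3).
- by rewrite (perm_big _ (type_concat_perm _ _)) big_cat /= sum_type_exact.
- by move=> n; rewrite excessE; case: (excess_exact n).
Qed.

Lemma hodge_fil_ker g :
  type_concat (hodge_type M1) (hodge_type M3) = hodge_type M2 ->
  (ph_fib f @: hodge_fil M1 g = hodge_fil M2 g :&: lker (ph_fib h))%VS.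
Proof.
move=> eq_t; have [basis1 _] := ad1; have [gen1 _] := basis1.
(* The shift by 1 comes from dividing by pi: if f x = m + pi m'' with m in pi^g M_2', then pi^(-1) f
   x lies in M_2 + pi^(g - 1) M_2'. *)
have [_ ker_fib] := excess_exact (g - 1).
apply/subv_anti/andP; split.
  rewrite subv_cap ph_fib_hodge; apply/subvP => _ /memv_imgP[d _ ->].
  rewrite memv_ker; have [x <-] := pm_red_surj d.
  by rewrite !ph_fib_ext (hf0 exact_fh) linear0.
apply/subvP => d; rewrite memv_cap memv_ker => /andP[/mem_hodge_fil F2d /eqP hd0].
have [x dE] := ph_fib_ker exact_fh hd0.
have [m [m' [[w [Mw mw]] dE']]] := F2d.
have [m'' fxE] : exists m'', f x = m + pi *: m''.
  have /pm_red_ker[m'' fxm] : pm_red M2 (f x - (m + pi *: m')) = 0.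
    by rewrite linearB -dE -dE' subrr.
  by exists (m' + m''); rewrite scalerDr addrA -fxm addrC subrK.
have pi0 := piL_neq0 B.
have /ker_fib[|a xE] : lspan (@tofrac A) (sum_lattice e2 gamma2 (g - 1))
    (ph_gen f (piL^-1 *: pm_inc M1 x)).
- rewrite linearZ /= ph_gen_ext fxE linearD incZ mw.
  have -> : piL^-1 *: (piL ^ g *: w + tofrac pi *: pm_inc M2 m'') =
      piL ^ (g - 1) *: w + pm_inc M2 m''.
    by rewrite scalerDr !scalerA mulVf // scale1r expfzDr // exprN1 mulrC.
  apply: submodD; first exact: lspan_submod.
    exact: sum_lattice_image.
  exact: sum_lattice_inc.
- by rewrite -eq_t (excess_perm _ (type_concat_perm _ _)) /excess big_cat.
have [c cE] := gen1 x.
(* For gamma_i <= g - 1 the exponent of pi in the i-th basis vector of M_1 + pi^(g - 1) M_1' is 0,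
   so that c_i = pi a_i. *)
have red_c i : gamma1 i < g -> wb_red B (c i) = 0.
  move=> gi; apply/redP; exists (a i); apply/eqP; rewrite -tofrac_eq.
  have [_ free1] := inc_basis basis1; rewrite -subr_eq0; apply/eqP.
  have := free1 (fun i => tofrac (c i) -
    piL * (tofrac (a i) * piL ^ lattice_exp gamma1 (g - 1) i)).
  rewrite tofracM => /(_ _ i) <-.
    by rewrite /lattice_exp min_l ?expr0z ?mulr1 // subr_ge0 lerBrDr lezD1.
  under eq_bigr do rewrite scalerBl -[X in _ - X]scalerA -[X in _ - _ *: X]scalerA.
  rewrite sumrB -inc_lincomb -cE -scaler_sumr -xE scalerA divff // scale1r.
  by rewrite subrr.
rewrite dE -ph_fib_ext; apply: memv_img; rewrite (hodge_filE _ ad1) cE redM_lincomb.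
rewrite (bigID (fun i => g <= gamma1 i)) /= [X in _ + X]big1 ?addr0 => [|i].
  by apply: memv_sumr => i _; apply/memvZ/memv_line.
by rewrite -ltNge => /red_c ->; rewrite scale0r.
Qed.

End AdaptedBases.

(** Exactness makes the dimensions of the F_H^g additive, and multiplicities in the type are
    differences of consecutive dimensions. *)
Lemma exact_type_eq : (forall g, fil_exact_at (ph_fib f) (ph_fib h)
    (hodge_fil M1) (hodge_fil M2) (hodge_fil M3) g) ->
  type_concat (hodge_type M1) (hodge_type M3) = hodge_type M2.
Proof.
move=> exact_g; apply: is_type_of_uniq (hodge_typeP M2); split.
  exact: sort_sorted ge_total _.
have dimE g : \dim (hodge_fil M2 g) =
    (\dim (hodge_fil M1 g) + \dim (hodge_fil M3 g))%N.
  have [f_inj kerE imE] := exact_g g.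
  by rewrite -(limg_ker_dim (ph_fib h)) -kerE imE limg_dim_eq.
move=> g; rewrite !dimE !dim_hodge_fil_type !(count_geS g) addnACA addnK.
rewrite -count_cat; apply: (elimT seq.permP); exact: type_concat_perm.
Qed.

Lemma exact_type_le :
  [/\ pm_rank M2 = (pm_rank M1 + pm_rank M3)%N,
      type_le (type_concat (hodge_type M1) (hodge_type M3)) (hodge_type M2) &
      type_concat (hodge_type M1) (hodge_type M3) = hodge_type M2 <->
      forall g : int, fil_exact_at (ph_fib f) (ph_fib h)
        (hodge_fil M1) (hodge_fil M2) (hodge_fil M3) g].
Proof.
have [e1 [gamma1 ad1]] := adapted_ex (erefl (pm_rank M1)).
have [e3 [gamma3 ad3]] := adapted_ex (erefl (pm_rank M3)).
have [_ _ surj_h] := exact_fh; have [l hl] := choice (fun j => surj_h (e3 j)).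
have rank2 := rank_basis (lifted_basis exact_fh ad1 ad3 hl).
have [e2 [gamma2 ad2]] := adapted_ex rank2.
split=> //; first exact: type_le_exact ad1 ad3 ad2 hl.
split; last exact: exact_type_eq.
move=> eq_t g; have kerE := hodge_fil_ker ad1 ad3 ad2 hl g eq_t.
have f_inj : (hodge_fil M1 g :&: lker (ph_fib f) = 0)%VS.
  apply/eqP; rewrite -subv0; apply/subvP => d.
  rewrite memv_cap memv_ker memv0 => /andP[_ /eqP fd0].
  by apply/eqP/(ph_fib_inj exact_fh).
split=> //; apply/eqP; rewrite eqEdim ph_fib_hodge /=.
have := limg_ker_dim (ph_fib h) (hodge_fil M2 g).
rewrite -kerE limg_dim_eq // !dim_hodge_fil_type -eq_t.
have /seq.permP -> := type_concat_perm (hodge_type M1) (hodge_type M3).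
by rewrite count_cat => /addnI ->.
Qed.

End ExactTypes.

Theorem proposition29 (R : realType) (B : witt_base R) :
  [/\ (* the Hodge filtration is a functor to filtered vector spaces *)
      (forall M : phimod B, is_filtration (hodge_fil M)) /\
      (forall (M N : phimod B) (f : phihom M N) (g : int),
         (ph_fib f @: hodge_fil M g <= hodge_fil N g)%VS),
      (* tensor products *)
      forall (M N T : phimod B) (b : phi_tensor M N T) (g : int),
        hodge_fil T g =
        tensor_fil (pt_fib b) (hodge_fil M) (hodge_fil N) g,
      (* duals *)
      forall (M N : phimod B) (e : phi_dual M N) (g : int),
        hodge_fil N g = dual_fil (pd_fib e) (hodge_fil M) g,
      (* symmetric and exterior powers *)
      (forall (k : nat) (M S : phimod B) (s : phi_sym_power k M S) (g : int),
        hodge_fil S g = power_fil (pp_fib s) (hodge_fil M) g) /\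
      (forall (k : nat) (M S : phimod B) (s : phi_ext_power k M S) (g : int),
        hodge_fil S g = power_fil (pp_fib s) (hodge_fil M) g) &
      (* Hodge types *)
      (forall M : phimod B,
        is_type_of (hodge_fil M) (hodge_type M) /\
        size (hodge_type M) = pm_rank M) /\
      (forall (M1 M2 M3 : phimod B) (f : phihom M1 M2) (h : phihom M2 M3),
        phi_short_exact f h ->
        [/\ pm_rank M2 = (pm_rank M1 + pm_rank M3)%N,
            type_le (type_concat (hodge_type M1) (hodge_type M3))
                    (hodge_type M2) &
            type_concat (hodge_type M1) (hodge_type M3) = hodge_type M2 <->
            forall g : int,
              fil_exact_at (ph_fib f) (ph_fib h)
                (hodge_fil M1) (hodge_fil M2) (hodge_fil M3) g])].
Proof.
split.
- by split=> *; [apply: hodge_filtration | apply: ph_fib_hodge].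
- by move=> *; apply: tensor_hodge.
- by move=> *; apply: dual_hodge.
- split=> k M S s g; apply: power_hodge; [left | right]; exact: pp_univ.
- split=> [M|M1 M2 M3 f h exact_fh]; last exact: exact_type_le.
  by split; [apply: hodge_typeP | apply: size_hodge_type].
Qed.
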